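(* Let $X$ be a Hausdorff space and $\gamma:X\times X\to\mathbb{R}$ a continuous conditionally negative definite kernel. The kernel $(x,y)\in X\times X\mapsto e^{-\gamma(x,y)}\in\mathbb{R}$ is integrally strictly positive definite (ISPD) if and only if $\gamma$ is metrizable and the function $x\in X\mapsto\gamma(x,x)\in\mathbb{R}$ is bounded from below.
   Context: A kernel $\gamma:X\times X\to\mathbb{R}$ is conditionally negative definite (CND) if $\gamma(x,y)=\gamma(y,x)$ and $\sum_{\mu,\nu=1}^{n}c_{\mu}c_{\nu}\gamma(x_{\mu},x_{\nu})\le 0$ for all finitely many distinct points $x_{1},\dots,x_{n}$ and $c_{1},\dots,c_{n}\in\mathbb{R}$ with $\sum_{\mu}c_{\mu}=0$. Every CND kernel can be written $\gamma(x,y)=\|h(x)-h(y)\|^{2}_{\mathcal{H}}+f(x)+f(y)$ with $\mathcal{H}$ a real Hilbert space, $h:X\to\mathcal{H}$ and $f(x)=\gamma(x,x)/2$; $\gamma$ is called metrizable if $h$ is injective, equivalently if $2\gamma(x,y)>\gamma(x,x)+\gamma(y,y)$ for all $x\neq y$ in $X$. A kernel $K:X\times X\to\mathbb{C}$ is positive definite if $\sum_{\mu,\nu=1}^{n}c_{\mu}\overline{c_{\nu}}K(x_{\mu},x_{\nu})\ge 0$ for all finitely many distinct points $x_{\mu}\in X$ and scalars $c_{\mu}\in\mathbb{C}$. Its reproducing kernel Hilbert space $\mathcal{H}_{K}$ is the Hilbert space of functions $F:X\to\mathbb{C}$ that contains $K_{y}:=K(\cdot,y)$ for every $y\in X$,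 satisfies $\langle F,K_{y}\rangle_{\mathcal{H}_{K}}=F(y)$, and in which $\mathrm{span}\{K_{y}:y\in X\}$ is dense. $\mathcal{M}(X)$ denotes the finite complex-valued Radon measures on $X$: complex Borel measures $\lambda$ with $|\lambda|$ finite and, for every Borel $E$, $|\lambda|(E)=\sup\{|\lambda|(K):K\subset E\text{ compact}\}=\inf\{|\lambda|(U):U\supset E\text{ open}\}$. A bounded positive definite kernel $K$ on a Hausdorff space $X$ with $\mathcal{H}_{K}\subset C(X)$ is ISPD if the only $\lambda\in\mathcal{M}(X)$ with $\int_{X}\int_{X}K(x,y)\,d\lambda(x)\,d\overline{\lambda}(y)=0$ is the zero measure. In particular, being ISPD includes being bounded. *)

(* Defs.v *)
From HB Require Import structures.
From mathcomp Require Import all_boot all_order all_algebra.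
From mathcomp Require Import all_classical all_reals all_analysis.
From mathcomp Require Import complex.

Set Implicit Arguments.
Unset Strict Implicit.
Unset Printing Implicit Defensive.

Import Order.TTheory GRing.Theory Num.Theory.
Import numFieldNormedType.Exports.

Local Open Scope classical_set_scope.
Local Open Scope ring_scope.
Local Open Scope complex_scope.

Section kernels.
Context {R : realType} {X : Type}.

Definition cond_neg_def (g : X -> X -> R) : Prop :=
  (forall x y, g x y = g y x) /\
  (forall (n : nat) (x : 'I_n -> X) (c : 'I_n -> R),
     injective x -> \sum_i c i = 0 ->
     \sum_i \sum_j c i * c j * g (x i) (x j) <= 0).

(* If g x y = |h x - h y|^2 + f x + f y with f x = g x x / 2, then
   2 * g x y - (g x x + g y y) = 2 * |h x - h y|^2, so this says that h is
   injective, whichever Hilbert space representation h is used. *)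
Definition metrizable (g : X -> X -> R) : Prop :=
  forall x y, x <> y -> g x x + g y y < 2 * g x y.

(* In the order of R[i], 0 <= z means that z is real and nonnegative. *)
Definition pos_def (K : X -> X -> R[i]) : Prop :=
  forall (n : nat) (x : 'I_n -> X) (c : 'I_n -> R[i]),
    injective x -> 0 <= \sum_i \sum_j c i * (c j)^* * K (x i) (x j).

(* H is the carrier of the space, ip its inner product, which is only
   meaningful on H. *)
Section rkhs.
Variables (K : X -> X -> R[i]) (H : set (X -> R[i])).
Variable ip : (X -> R[i]) -> (X -> R[i]) -> R[i].

Definition ip_dist (F G : X -> R[i]) : R :=
  let D x := F x - G x in Num.sqrt (complex.Re (ip D D)).

Record is_rkhs : Prop := {
  rkhs0 : H (fun=> 0);
  rkhs_lin : forall (a : R[i]) F G, H F -> H G -> H (fun x => a * F x + G x);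
  rkhs_ip_lin : forall (a : R[i]) F G L, H F -> H G -> H L ->
    ip (fun x => a * F x + G x) L = a * ip F L + ip G L;
  rkhs_ip_herm : forall F G, H F -> H G -> ip G F = (ip F G)^*;
  rkhs_ip_ge0 : forall F, H F -> 0 <= ip F F;
  rkhs_ip_eq0 : forall F, H F -> ip F F = 0 -> F = (fun=> 0);
  rkhs_complete : forall u : nat -> X -> R[i], (forall n, H (u n)) ->
    (forall e : R, 0 < e -> exists N, forall m n,
       (N <= m)%N -> (N <= n)%N -> ip_dist (u m) (u n) < e) ->
    exists2 F, H F & forall e : R, 0 < e ->
      exists N, forall n, (N <= n)%N -> ip_dist (u n) F < e;
  rkhs_kernel : forall y, H (K ^~ y);
  rkhs_repr : forall F y, H F -> ip F (K ^~ y) = F y;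
  rkhs_dense : forall F, H F -> forall e : R, 0 < e ->
    exists (n : nat) (c : 'I_n -> R[i]) (y : 'I_n -> X),
      ip_dist F (fun x => \sum_i c i * K x (y i)) < e
}.
End rkhs.
End kernels.

(* Measurable types are pointed in the library, hence the base point; it plays
   no role in the topology or in the sigma-algebra. *)
Definition based (X : topologicalType) (x0 : X) : Type := X.
HB.instance Definition _ (X : topologicalType) (x0 : X) :=
  Topological.on (based x0).
HB.instance Definition _ (X : topologicalType) (x0 : X) :=
  isPointed.Build (based x0) x0.

Definition borel (X : topologicalType) (x0 : X) :=
  g_sigma_algebraType (@open (based x0)).
HB.instance Definition _ (X : topologicalType) (x0 : X) :=
  Measurable.on (borel x0).

Section charge_integral.
Context d (T : measurableType d) (R : realType).
Variable nu : {charge set T -> \bar R}.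

Definition hahn_pos : set T := projT1 (cid (Hahn_decomposition nu)).
Definition hahn_neg : set T :=
  projT1 (cid (projT2 (cid (Hahn_decomposition nu)))).
Lemma hahn_posneg : hahn_decomposition nu hahn_pos hahn_neg.
Proof. exact: projT2 (cid (projT2 (cid (Hahn_decomposition nu)))). Qed.

Definition charge_integral (f : T -> R) : R :=
  Rintegral (jordan_pos hahn_posneg) setT f -
  Rintegral (jordan_neg hahn_posneg) setT f.
End charge_integral.

(* Charges are finite signed measures, so a complex measure is a pair of them:
   its real and imaginary parts. *)
Record complex_measure d (T : measurableType d) (R : realType) := ComplexMeasure {
  cm_re : {charge set T -> \bar R};
  cm_im : {charge set T -> \bar R}
}.

Section complex_measure.
Context d (T : measurableType d) (R : realType).
Implicit Type l : complex_measure T R.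

Definition cm_val l (A : set T) : R[i] := fine (cm_re l A) +i* fine (cm_im l A).

Definition cm_conj l : complex_measure T R :=
  ComplexMeasure (cm_re l) (copp (cm_im l)).

Definition cm_integral l (f : T -> R[i]) : R[i] :=
  let u x := complex.Re (f x) in
  let v x := complex.Im (f x) in
  (charge_integral (cm_re l) u - charge_integral (cm_im l) v) +i*
  (charge_integral (cm_re l) v + charge_integral (cm_im l) u).

Definition cm_variation l (E : set T) : \bar R :=
  ereal_sup [set (\sum_(0 <= i <oo) (complex.Re `|cm_val l (F i)|)%:E)%E
            | F in [set F : nat -> set T |
                [/\ forall i, measurable (F i), trivIset setT F
                  & \bigcup_i F i = E]]].
End complex_measure.

Section ispd.
Context {R : realType} {X : topologicalType}.

Definition radon (x0 : X) (l : complex_measure (borel x0) R) : Prop :=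
  (cm_variation l setT < +oo)%E /\
  forall E : set (borel x0), measurable E ->
    cm_variation l E =
      ereal_sup [set cm_variation l C
                | C in [set C : set X | compact C /\ C `<=` E]] /\
    cm_variation l E =
      ereal_inf [set cm_variation l U
                | U in [set U : set X | open U /\ E `<=` U]].

(* In ispd_rkhs, H ranges over the reproducing kernel Hilbert spaces of K; as K
   is positive definite there is exactly one (Moore-Aronszajn).
   In ispd_measure, the quantification on x0 only supplies the base point needed
   to form the Borel measurable type; on an empty X every measure is zero. *)
Record ispd (K : X -> X -> R[i]) : Prop := {
  ispd_bounded : exists M : R, forall x y, `|K x y| <= M%:C;
  ispd_pos_def : pos_def K;
  ispd_rkhs : forall H ip, is_rkhs K H ip ->
    forall F, H F -> continuous (F : X -> R[i]^o);
  ispd_measure : forall (x0 : X) (l : complex_measure (borel x0) R), radon l ->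
    cm_integral (cm_conj l) (fun y => cm_integral l (fun x => K x y)) = 0 ->
    forall A : set (borel x0), measurable A -> cm_val l A = 0
}.
End ispd.

(* Main.v *)
Require Import Defs.
From mathcomp Require Import all_boot all_order all_algebra.
From mathcomp Require Import all_classical all_reals all_analysis.
From mathcomp Require Import measurable_realfun complex ring lra.
Import Order.TTheory GRing.Theory Num.Theory.
Import numFieldNormedType.Exports.
Local Open Scope classical_set_scope.
Local Open Scope ring_scope.
Local Open Scope complex_scope.
Set Implicit Arguments.
Unset Strict Implicit.

(* Fix a point z and put k(x,y) = g(x,z) + g(z,y) - g(x,y) - g(z,z), which is
   positive definite; then exp(-g(x,y)) = W(x) W(y) exp(k(x,y)) with W > 0.
   Continuous bounded positive definite kernels have nonnegative double
   integrals against Radon measures. If F is in the reproducing kernel space of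
   k, i.e. C k(x,y) - F(x) F(y) is positive definite for some C, then, by the
   Schur product theorem, so is n! C^n exp(k) - F^n F^n; hence a real measure nu
   whose double integral against exp(-g) vanishes satisfies
   int W F^n dnu = 0 for all n, and int W cos(F + a) dnu = 0 by summing the
   series. The functions that multiply the annihilator of {cos(F + a)} into itself
   form an algebra closed under bounded pointwise limits and containing every
   cos(F + a), hence containing enough indicator functions to separate disjoint compact
   sets when g is metrizable. Applied to compact subsets of the two sets of a
   Hahn decomposition of nu, this gives nu = 0.
   Conversely, if 2 g(x,y) = g(x,x) + g(y,y) with x <> y, the measure
   exp(g(x,x)/2) delta_x - exp(g(y,y)/2) delta_y has vanishing double
   integral. *)

(** * Positive definite real kernels *)

(** The lower bound on the diagonal enters through [W x ^+ 2 * expR (k x x) = expR (- g x x)]: it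
    bounds [W] times the exponential of [|F|] although [F] may be unbounded, which is what allows
    the series to be integrated term by term. Cosines then replace powers of [F] because they are
    bounded and their products are again combinations of cosines. Two usual ways to conclude are
    closed. Disjoint compact sets, however, are separated by finitely many Boolean operations, and
    inner regularity reduces Borel sets to compact ones. For a similar reason double integrals are
    iterated integrals, approximated by step functions: a continuous kernel can fail to be
    measurable for the product sigma-algebra. *)

Section pd_kernels.
Context {R : realType} {X : Type}.
Implicit Types P Q : X -> X -> R.

(* Unlike in [pos_def], the points may be repeated. *)
Definition pd_kernel P : Prop :=
  (forall x y, P x y = P y x) /\
  forall n (x : 'I_n -> X) (c : 'I_n -> R),
    0 <= \sum_i \sum_j c i * c j * P (x i) (x j).

Lemma quadratic_discr (a b d : R) :
  (forall s, 0 <= s ^+ 2 * a + 2 * s * b + d) -> b ^+ 2 <= a * d.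
Proof.
move=> h; have d0 := h 0; rewrite expr0n/= mul0r mulr0 mul0r !add0r in d0.
case: (ltgtP a 0) => a0.
(* A root of [s ^+ 2 * a + 2 * s * b + d = -1]; it is real because [a < 0 <= d]. *)
- have := h ((- b - Num.sqrt (b ^+ 2 - a * (d + 1))) / a).
  set q := Num.sqrt _.
  have q2 : q ^+ 2 = b ^+ 2 - a * (d + 1).
    by rewrite sqr_sqrtr// subr_ge0; apply: le_trans (sqr_ge0 _); nra.
  have -> : ((- b - q) / a) ^+ 2 * a + 2 * ((- b - q) / a) * b + d =
     (q ^+ 2 - b ^+ 2) / a + d by field; rewrite lt_eqF.
  rewrite q2 (_ : _ + d = -1); first by rewrite oppr_ge0 ler10.
  by field; rewrite lt_eqF.
- have := h (- b / a).
  have -> : (- b / a) ^+ 2 * a + 2 * (- b / a) * b + d = (a * d - b ^+ 2) / a.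
    by field; rewrite gt_eqF.
  by rewrite pmulr_lge0 ?invr_gt0// subr_ge0.
- rewrite a0 mul0r; case: (eqVneq b 0) => [->|b0]; first by rewrite expr0n.
  have := h (- (d + 1) / (2 * b)); rewrite a0 mulr0 add0r.
  have -> : 2 * (- (d + 1) / (2 * b)) * b + d = -1 by field.
  by rewrite oppr_ge0 ler10.
Qed.

Lemma sum_point_cons P y s n (x : 'I_n -> X) (c : 'I_n -> R) :
  (forall u v, P u v = P v u) ->
  let x' i := oapp x y (unlift ord0 i) in
  let c' i := oapp c s (unlift ord0 i) in
  \sum_(i < n.+1) \sum_(j < n.+1) c' i * c' j * P (x' i) (x' j) =
  s ^+ 2 * P y y + 2 * s * (\sum_i c i * P (x i) y) +
  \sum_i \sum_j c i * c j * P (x i) (x j).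
Proof.
move=> sP /=; rewrite big_ord_recl unlift_none /= big_ord_recl unlift_none /=.
under eq_bigr do rewrite liftK/=.
under [X in _ + X = _]eq_bigr do
  (rewrite big_ord_recl liftK unlift_none /=; under eq_bigr do rewrite liftK/=).
rewrite big_split/= -expr2 -!addrA; congr +%R; rewrite addrA; congr +%R.
rewrite -mulrA mulr_natl mulr2n; congr +%R; rewrite mulr_sumr;
  apply: eq_bigr => i _; rewrite ?(sP y); ring.
Qed.

Lemma pd_cons P y n (x : 'I_n -> X) (c : 'I_n -> R) s : pd_kernel P ->
  0 <= s ^+ 2 * P y y + 2 * s * (\sum_i c i * P (x i) y) +
       \sum_i \sum_j c i * c j * P (x i) (x j).
Proof. by move=> [sP hP]; rewrite -sum_point_cons. Qed.

(** Cauchy-Schwarz in the reproducing kernel space, without constructing it: the form in [pd_cons]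
    is a nonnegative quadratic polynomial in the coefficient [s] of the extra point [y]. *)
Lemma pd_cauchy P y n (x : 'I_n -> X) (c : 'I_n -> R) : pd_kernel P ->
  (\sum_i c i * P (x i) y) ^+ 2 <=
  P y y * \sum_i \sum_j c i * c j * P (x i) (x j).
Proof. by move=> hP; apply: quadratic_discr => s; apply: pd_cons. Qed.

Lemma pd_ge0 P x : pd_kernel P -> 0 <= P x x.
Proof.
by move=> [_ /(_ 1%N (fun=> x) (fun=> 1))]; rewrite !big_ord1 !mul1r.
Qed.

Lemma pd_cauchy1 P x y : pd_kernel P -> P x y ^+ 2 <= P x x * P y y.
Proof.
move=> hP; have := pd_cauchy y (fun _ : 'I_1 => x) (fun=> 1) hP.
by rewrite !big_ord1 !mul1r mulrC.
Qed.

(** The squared distance between the kernel functions at [x] and [x'] in the reproducing kernel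
    space of [P]. *)
Definition pd_dist2 P x x' : R := P x x + P x' x' - 2 * P x x'.

Lemma pd_dist2xx P x : pd_dist2 P x x = 0.
Proof. by rewrite /pd_dist2; ring. Qed.

Lemma pd_cauchy2 P x x' y : pd_kernel P ->
  (P x y - P x' y) ^+ 2 <= P y y * pd_dist2 P x x'.
Proof.
move=> hP; have := pd_cauchy y (fun i : 'I_2 => if i == 0 then x else x')
  (fun i => if i == 0 then 1 else -1) hP.
rewrite !big_ord_recl !big_ord0 /= !addr0 !mul1r !mulN1r ?mulrNN ?mulN1r ?mulr1 ?opprK.
rewrite (hP.1 x' x) => /le_trans; apply.
by rewrite le_eqVlt /pd_dist2; apply/orP; left; apply/eqP; ring.
Qed.

Lemma pd_dist2_ge0 P x y : pd_kernel P -> 0 <= pd_dist2 P x y.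
Proof.
move=> [sP /(_ 2 (fun i => if i == 0 then x else y) (fun i => if i == 0 then 1 else -1))].
rewrite !big_ord_recl !big_ord0 /= !addr0 (sP y x) /pd_dist2; lra.
Qed.

Lemma pd_rank1 (f : X -> R) : pd_kernel (fun x y => f x * f y).
Proof.
split=> [x y|n x c]; first exact: mulrC.
rewrite (_ : \sum_i _ = (\sum_i c i * f (x i)) ^+ 2) ?sqr_ge0//.
rewrite expr2 mulr_suml; apply: eq_bigr => i _.
by rewrite mulr_sumr; apply: eq_bigr => j _; ring.
Qed.

Lemma pdD P Q : pd_kernel P -> pd_kernel Q ->
  pd_kernel (fun x y => P x y + Q x y).
Proof.
move=> [sP hP] [sQ hQ]; split=> [x y|n x c]; first by rewrite sP sQ.
under eq_bigr do (under eq_bigr do rewrite mulrDr; rewrite big_split).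
by rewrite big_split addr_ge0.
Qed.

Lemma pdZ (a : R) P : 0 <= a -> pd_kernel P -> pd_kernel (fun x y => a * P x y).
Proof.
move=> a0 [sP hP]; split=> [x y|n x c]; first by rewrite sP.
under eq_bigr do (under eq_bigr do rewrite mulrCA; rewrite -mulr_sumr).
by rewrite -mulr_sumr mulr_ge0.
Qed.

Lemma eq_pd P Q : (forall x y, P x y = Q x y) -> pd_kernel P -> pd_kernel Q.
Proof.
by move=> e; have -> // : P = Q; apply/funext => x; apply/funext => y.
Qed.

Lemma pd_cvg (P_ : nat -> X -> X -> R) P : (forall n, pd_kernel (P_ n)) ->
  (forall x y, P_ ^~ x ^~ y @ \oo --> P x y) -> pd_kernel P.
Proof.
move=> hP cP; split=> [x y|n x c].
  have := cP y x; rewrite (_ : (fun m => P_ m y x) = P_ ^~ x ^~ y).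
    by move=> /(cvg_unique (@Rhausdorff R) (cP x y)).
  by apply/funext => m; rewrite (hP m).1.
have cS : (fun m => \sum_i \sum_j c i * c j * P_ m (x i) (x j)) @ \oo -->
   \sum_i \sum_j c i * c j * P (x i) (x j).
  apply: cvg_big => [|i _]; first exact: add_continuous.
  apply: cvg_big => [|j _]; first exact: add_continuous.
  by apply: cvgM; [exact: cvg_cst|exact: cP].
rewrite -(cvg_lim _ cS)//; apply: limr_ge; first by apply/cvg_ex; eexists; exact: cS.
by apply: nearW => m; exact: (hP m).2.
Qed.


(** The quadratic form is the gap in [pd_cauchy]. Read differently, the slice of [P] at [y] belongs
    to the reproducing kernel space of [P], with constant [P y y]. *)
Lemma pd_schur_compl P y : pd_kernel P ->
  pd_kernel (fun u v => P y y * P u v - P u y * P v y).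
Proof.
move=> hP; split=> [u v|n x c]; first by rewrite (hP.1 u) mulrC [P v y * _]mulrC mulrC.
rewrite (_ : \sum_i _ = P y y * (\sum_i \sum_j c i * c j * P (x i) (x j)) -
  (\sum_i c i * P (x i) y) ^+ 2) ?subr_ge0 ?pd_cauchy//.
rewrite mulr_sumr expr2 mulr_suml -sumrB; apply: eq_bigr => i _.
by rewrite !mulr_sumr -sumrB; apply: eq_bigr => j _; ring.
Qed.

(* The Schur complement [P - P(., y) P(., y) / P(y, y)] at the first point [y]
   has a vanishing row there, so that the remaining sum has one point less. *)
Lemma pdM P Q : pd_kernel P -> pd_kernel Q ->
  pd_kernel (fun x y => P x y * Q x y).
Proof.
move=> hP hQ; split=> [x y|n]; first by rewrite hP.1 hQ.1.
elim: n P hP => [|n IH] P hP x c; first by rewrite big_ord0.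
have drop_row P' : pd_kernel P' -> (forall u, P' u (x ord0) = 0) ->
    0 <= \sum_i \sum_j c i * c j * (P' (x i) (x j) * Q (x i) (x j)).
  move=> hP' P'0; rewrite big_ord_recl big1 ?add0r => [|j _].
    under eq_bigr do rewrite big_ord_recl P'0 mul0r mulr0 add0r.
    exact: (IH _ hP' (x \o lift ord0) (c \o lift ord0)).
  by rewrite hP'.1 P'0 mul0r mulr0.
set y := x ord0.
have [Py0|Py0] := eqVneq (P y y) 0.
  apply: drop_row => // u; apply/eqP; rewrite -sqrf_eq0 eq_le sqr_ge0 andbT.
  by have := pd_cauchy1 u y hP; rewrite Py0 mulr0.
have Py_gt0 : 0 < P y y by rewrite lt_neqAle eq_sym Py0 pd_ge0.
rewrite -(pmulr_rge0 _ Py_gt0).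
have h1 := drop_row _ (pd_schur_compl y hP)
  (fun u => ltac:(by rewrite /= mulrC -/y subrr)).
have h2 := hQ.2 _ x (fun i => c i * P (x i) y).
rewrite (_ : _ * _ = \sum_i \sum_j c i * c j *
   ((P y y * P (x i) (x j) - P (x i) y * P (x j) y) * Q (x i) (x j)) +
   \sum_i \sum_j c i * P (x i) y * (c j * P (x j) y) * Q (x i) (x j)).
  exact: addr_ge0.
rewrite mulr_sumr -big_split; apply: eq_bigr => i _.
by rewrite mulr_sumr -big_split; apply: eq_bigr => j _ /=; ring.
Qed.

Lemma pdX P n : pd_kernel P -> pd_kernel (fun x y => P x y ^+ n).
Proof.
move=> hP; elim: n => [|n IH].
  by apply: eq_pd (pd_rank1 (fun=> 1)) => x y; rewrite mul1r expr0.
by apply: eq_pd (pdM hP IH) => x y; rewrite exprS.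
Qed.

(** Telescoping: the kernel for [n.+1] is [P] times the kernel for [n], plus the kernel for 1 times
    the rank one kernel of [f ^+ n]; both are Schur products. *)
Lemma pd_subX P (f : X -> R) n : pd_kernel P ->
  pd_kernel (fun x y => P x y - f x * f y) ->
  pd_kernel (fun x y => P x y ^+ n - f x ^+ n * f y ^+ n).
Proof.
move=> hP hd; elim: n => [|n IH].
  apply: eq_pd (pdZ (lexx 0) hP) => x y; rewrite !expr0; ring.
apply: eq_pd (pdD (pdM hP IH) (pdM hd (pd_rank1 (fun x => f x ^+ n)))) => x y.
rewrite !exprS; ring.
Qed.

Lemma pd_sum (I : Type) (r : seq I) (p : pred I) (P_ : I -> X -> X -> R) :
  (forall i, p i -> pd_kernel (P_ i)) ->
  pd_kernel (fun x y => \sum_(i <- r | p i) P_ i x y).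
Proof.
move=> hP; elim: r => [|i r IH].
  by apply: eq_pd (pd_rank1 (fun=> 0)) => x y; rewrite big_nil mul0r.
have [pi|pi] := boolP (p i).
  by apply: eq_pd (pdD (hP i pi) IH) => x y; rewrite big_cons pi.
by apply: eq_pd IH => x y; rewrite big_cons (negbTE pi).
Qed.

Lemma pd_exp_subX P m : pd_kernel P ->
  pd_kernel (fun x y => expR (P x y) - P x y ^+ m / m`!%:R).
Proof.
move=> hP; have hX k : pd_kernel (fun x y => P x y ^+ k / k`!%:R).
  apply: eq_pd (pdZ _ (pdX k hP)) => [x y|]; first exact: mulrC.
  by rewrite invr_ge0.
(* The index range starts with length [m.+1], so that every partial sum contains the term [m] that
   is left out. *)
apply: (pd_cvg (P_ := fun n x y =>
    \sum_(i <- index_iota 0 (n + m.+1) | i != m) P x y ^+ i / i`!%:R)) => [n|x y].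
  exact: pd_sum.
rewrite (_ : (fun n => _) = (fun n => series (exp_coeff (P x y)) (n + m.+1)%N
     - P x y ^+ m / m`!%:R)).
  apply: cvgB; last exact: cvg_cst.
  rewrite (cvg_shiftn m.+1 (series (exp_coeff (P x y)))).
  exact: is_cvg_series_exp_coeff.
apply/funext => n; rewrite /series/= /exp_coeff/= (bigD1_seq m) ?iota_uniq//=.
  by rewrite addrAC subrr add0r.
by rewrite mem_index_iota addnS ltnS leq_addl.
Qed.

Lemma pd_exp P : pd_kernel P -> pd_kernel (fun x y => expR (P x y)).
Proof.
move=> hP; apply: eq_pd (pdD (pd_exp_subX 0 hP) (pd_rank1 (fun=> 1))) => x y.
by rewrite expr0 fact0 divr1 mul1r subrK.
Qed.

(* The last hypothesis says that [F] is in the reproducing kernel space of [P]. *)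
Lemma pd_exp_dominates P (F : X -> R) C n : pd_kernel P -> 0 <= C ->
  pd_kernel (fun x y => C * P x y - F x * F y) ->
  pd_kernel (fun x y => n`!%:R * C ^+ n * expR (P x y) - F x ^+ n * F y ^+ n).
Proof.
move=> hP C0 hF.
have h1 := pdZ (mulr_ge0 (ler0n R n`!) (exprn_ge0 n C0)) (pd_exp_subX n hP).
apply: eq_pd (pdD h1 (pd_subX n (pdZ C0 hP) hF)) => x y.
rewrite exprMn; field; rewrite pnatr_eq0 -lt0n; exact: fact_gt0.
Qed.

End pd_kernels.

(** * Conditionally negative definite kernels *)

Section cnd_kernels.
Context {R : realType} {X : topologicalType}.
Implicit Types g : X -> X -> R.

(* Repeated points are merged by adding their coefficients. *)
Lemma cnd_repeated g n (x : 'I_n -> X) (c : 'I_n -> R) : cond_neg_def g ->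
  \sum_i c i = 0 -> \sum_i \sum_j c i * c j * g (x i) (x j) <= 0.
Proof.
move=> [_ hg] c0.
pose s := undup (codom x).
pose y (k : 'I_(size s)) := tnth (in_tuple s) k.
have y_inj : injective y by apply/tuple_uniqP; exact: undup_uniq.
have xy i : exists k, x i = y k.
  have /(tnthP (in_tuple s)) : x i \in s by rewrite mem_undup codom_f.
  by [].
pose d k := \sum_(i | x i == y k) c i.
have merge (h : X -> R) : \sum_k d k * h (y k) = \sum_i c i * h (x i).
  rewrite /d; under eq_bigr do rewrite mulr_suml.
  rewrite (exchange_big_dep predT)//=; apply: eq_bigr => i _.
  have [k xk] := xy i; rewrite (big_pred1 k) ?xk// => l.
  by rewrite /= inj_eq// eq_sym.
have /(hg _ _ d y_inj) : \sum_k d k = 0.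
  under eq_bigr do rewrite -[d _]mulr1.
  by rewrite (merge (fun=> 1)); under eq_bigr do rewrite mulr1.
congr (_ <= 0).
transitivity (\sum_k d k * \sum_j c j * g (y k) (x j)).
  apply: eq_bigr => k _; rewrite -merge mulr_sumr.
  by apply: eq_bigr => l _; rewrite mulrA.
rewrite (merge (fun z => \sum_j c j * g z (x j))).
by apply: eq_bigr => i _; rewrite mulr_sumr; apply: eq_bigr => l _; rewrite mulrA.
Qed.

(* Twice the inner product of [h x - h z] and [h y - h z] when
   [g x y = |h x - h y|^2 + f x + f y]. *)
Definition pd_of_cnd g z x y : R := g x z + g z y - g x y - g z z.

(** Adding the point [z] with coefficient [- \sum_i c i] makes the coefficients sum to 0; the form
    of [g] on the enlarged family is minus the form of [pd_of_cnd g z]. Since [z] may be one of the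
    points, [cnd_repeated] is required. *)
Lemma pd_of_cnd_pd g z : cond_neg_def g -> pd_kernel (pd_of_cnd g z).
Proof.
move=> hg; split=> [x y|n x c].
  by rewrite /pd_of_cnd (hg.1 x z) (hg.1 z y) (hg.1 x y); ring.
have := @cnd_repeated g n.+1 (fun i => oapp x z (unlift ord0 i))
   (fun i => oapp c (- \sum_i c i) (unlift ord0 i)) hg.
rewrite (sum_point_cons _ _ _ _ hg.1) big_ord_recl unlift_none/=.
under [X in _ + X = 0 -> _]eq_bigr do rewrite liftK/=.
rewrite addNr => /(_ erefl); rewrite -oppr_ge0; congr (0 <= _).
set S := \sum_i c i; set U := \sum_i c i * g (x i) z.
rewrite [RHS](eq_bigr (fun i => c i * g (x i) z * S + c i * U - c i * g z z * S -
   \sum_j c i * c j * g (x i) (x j))) => [|i _]; last first.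
  rewrite /S /U !mulr_sumr -big_split -sumrB -sumrB; apply: eq_bigr => j _ /=.
  by rewrite /pd_of_cnd (hg.1 z); ring.
rewrite !sumrB big_split/= -!mulr_suml -/S -/U; ring.
Qed.

Lemma expN_pd_of_cnd g z x y : cond_neg_def g ->
  expR (- g x y) = expR (g z z / 2 - g x z) * expR (g z z / 2 - g y z) *
    expR (pd_of_cnd g z x y).
Proof.
by move=> hg; rewrite -!expRD /pd_of_cnd (hg.1 z y); congr expR; field.
Qed.

Lemma cnd_expN_pd g : cond_neg_def g -> pd_kernel (fun x y => expR (- g x y)).
Proof.
move=> hg; split=> [x y|[|n] x c]; first by rewrite hg.1.
  by rewrite big_ord0.
(* Any base point would do; taking one of the given points avoids assuming that [X] is inhabited. *)
set z := x ord0.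
have := pdM (pd_rank1 (fun u => expR (g z z / 2 - g u z)))
  (pd_exp (pd_of_cnd_pd z hg)).
move=> [_] /(_ n.+1 x c); congr (0 <= _); apply: eq_bigr => i _.
by apply: eq_bigr => j _; rewrite (expN_pd_of_cnd z).
Qed.

Lemma cnd_diag_le g x y : cond_neg_def g -> g x x + g y y <= 2 * g x y.
Proof.
move=> hg; have := pd_dist2_ge0 x y (pd_of_cnd_pd x hg).
by rewrite /pd_dist2 /pd_of_cnd (hg.1 y x); lra.
Qed.

End cnd_kernels.

(** * Integration of bounded functions against a charge *)

Section bounded_measurable.
Context d (T : measurableType d) (R : realType).
Implicit Types f g : T -> R.

Definition bounded_measurable f : Prop :=
  measurable_fun setT f /\ exists M, forall x, `|f x| <= M.

Lemma bm_cst (a : R) : bounded_measurable (fun=> a).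
Proof. by split; [exact: measurable_cst|exists `|a|]. Qed.

Lemma bmD f g : bounded_measurable f -> bounded_measurable g ->
  bounded_measurable (fun x => f x + g x).
Proof.
move=> [mf [M fM]] [mg [N gN]]; split; first exact: measurable_funD.
by exists (M + N) => x; rewrite (le_trans (ler_normD _ _))// lerD.
Qed.

Lemma bmM f g : bounded_measurable f -> bounded_measurable g ->
  bounded_measurable (fun x => f x * g x).
Proof.
move=> [mf [M fM]] [mg [N gN]]; split; first exact: measurable_funM.
by exists (M * N) => x; rewrite normrM ler_pM.
Qed.

Lemma bmZ a f : bounded_measurable f -> bounded_measurable (fun x => a * f x).
Proof. exact: (bmM (bm_cst a)). Qed.

Lemma bmB f g : bounded_measurable f -> bounded_measurable g ->
  bounded_measurable (fun x => f x - g x).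
Proof.
move=> bf bg; under eq_fun do rewrite -mulN1r.
by apply: bmD => //; exact: bmZ.
Qed.

Lemma bm_sum (I : Type) (r : seq I) (F : I -> T -> R) :
  (forall i, bounded_measurable (F i)) ->
  bounded_measurable (fun x => \sum_(i <- r) F i x).
Proof.
move=> bF; elim: r => [|i r IH].
  by under eq_fun do rewrite big_nil; exact: bm_cst.
by under eq_fun do rewrite big_cons; exact: bmD.
Qed.

Lemma bm_indic (A : set T) : measurable A -> bounded_measurable (\1_A).
Proof.
move=> mA; split; first exact: measurable_indic.
by exists 1 => x; rewrite indicE; case: (_ \in _); rewrite ?normr1 ?normr0.
Qed.

Lemma bm_cvg (f_ : nat -> T -> R) f (M : R) :
  (forall n, measurable_fun setT (f_ n)) -> (forall n x, `|f_ n x| <= M) ->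
  (forall x, f_ ^~ x @ \oo --> f x) -> bounded_measurable f.
Proof.
move=> mf_ fM cf; split.
  apply: (@measurable_fun_cvg _ _ _ _ f_) => // x _; exact: cf.
exists M => x; have h : (fun n => `|f_ n x|) @ \oo --> `|f x|.
  by apply: cvg_norm; exact: cf.
rewrite -(cvg_lim _ h)//.
by apply: limr_le; [apply/cvg_ex; eexists; exact: h|exact: nearW].
Qed.

Context (mu : {finite_measure set T -> \bar R}).

Lemma bm_integrable f : bounded_measurable f -> mu.-integrable setT (EFin \o f).
Proof.
move=> [mf [M fM]]; apply: measurable_bounded_integrable => //.
  exact: fin_num_fun_lty.
by exists M; split; [exact: num_real|move=> N MN x _; exact: le_trans (fM x) (ltW MN)].
Qed.

Lemma Rintegral_bounded_cvg (f_ : nat -> T -> R) f (M : R) :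
  (forall n, measurable_fun setT (f_ n)) -> (forall n x, `|f_ n x| <= M) ->
  (forall x, f_ ^~ x @ \oo --> f x) ->
  (fun n => Rintegral mu setT (f_ n)) @ \oo --> Rintegral mu setT f.
Proof.
move=> mf_ fM cf; have [mf _] := bm_cvg mf_ fM cf.
have [] := @dominated_convergence _ T R mu setT measurableT
  (fun n => EFin \o f_ n) (EFin \o f) (EFin \o cst M).
- by move=> n; exact/measurable_EFinP.
- exact/measurable_EFinP.
- by apply: aeW => x _; apply: cvg_EFin; [exact: nearW|exact: cf].
- by apply: bm_integrable; exact: bm_cst.
- by apply: aeW => x n _ /=; rewrite lee_fin.
move=> _ _ h; apply: fine_cvg; rewrite fineK//.
by apply: integrable_fin_num => //; apply: bm_integrable; exact: (bm_cvg mf_ fM cf).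
Qed.

(** Meant for a compact [C] carrying almost all the mass, with [b] small: a crude bound [a] suffices
    off [C]. *)
Lemma normr_Rintegral_split f (C : set T) (a b : R) : measurable C ->
  bounded_measurable f -> 0 <= a -> 0 <= b ->
  (forall x, `|f x| <= a) -> (forall x, C x -> `|f x| <= b) ->
  `|Rintegral mu setT f| <= b * fine (mu setT) + a * fine (mu (~` C)).
Proof.
move=> mC bf a0 b0 fa fb.
apply: le_trans (le_normr_Rintegral measurableT (bm_integrable bf)) _.
have -> : b * fine (mu setT) + a * fine (mu (~` C)) =
    Rintegral mu setT (fun x => b + a * \1_(~` C) x).
  rewrite RintegralD//; first last.
  - by apply: bm_integrable; apply: bmZ; apply: bm_indic; exact: measurableC.
  - by apply: bm_integrable; exact: bm_cst.
  rewrite RintegralZl//; last first.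
    by apply: bm_integrable; apply: bm_indic; exact: measurableC.
  rewrite Rintegral_cst//; congr (_ + a * _).
  by rewrite /Rintegral integral_indic ?setIT//; exact: measurableC.
apply: le_Rintegral => //.
- apply: bm_integrable; split; last by exists a => x; rewrite normr_id.
  by apply: measurableT_comp => //; exact: bf.1.
- apply: bm_integrable; apply: bmD; first exact: bm_cst.
  by apply: bmZ; apply: bm_indic; exact: measurableC.
move=> x _; rewrite indicE; have [Cx|nCx] := pselect (C x).
  by rewrite memNset/= ?mulr0 ?addr0 ?fb//; exact.
by rewrite mem_set//= mulr1 (le_trans (fa x))// lerDr.
Qed.

End bounded_measurable.

Section charge_integral_theory.
Context d (T : measurableType d) (R : realType).
Variable nu : {charge set T -> \bar R}.
Implicit Types f g : T -> R.
Local Notation mp := (jordan_pos (hahn_posneg nu)).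
Local Notation mn := (jordan_neg (hahn_posneg nu)).

Lemma charge_integralD f g : bounded_measurable f -> bounded_measurable g ->
  charge_integral nu (fun x => f x + g x) =
  charge_integral nu f + charge_integral nu g.
Proof.
move=> bf bg; rewrite /charge_integral !RintegralD//; try exact: bm_integrable.
ring.
Qed.

Lemma charge_integralZ a f : bounded_measurable f ->
  charge_integral nu (fun x => a * f x) = a * charge_integral nu f.
Proof.
move=> bf; rewrite /charge_integral !RintegralZl//; try exact: bm_integrable.
ring.
Qed.

Lemma charge_integralB f g : bounded_measurable f -> bounded_measurable g ->
  charge_integral nu (fun x => f x - g x) =
  charge_integral nu f - charge_integral nu g.
Proof.
move=> bf bg; under [in LHS]eq_fun do rewrite -mulN1r.
by rewrite charge_integralD ?charge_integralZ ?mulN1r//; exact: bmZ.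
Qed.

Lemma charge_integral0 : charge_integral nu (fun=> 0) = 0.
Proof.
by rewrite -[RHS](mul0r (charge_integral nu (fun=> 0))) -charge_integralZ ?mul0r//;
  exact: bm_cst.
Qed.

Lemma charge_integral_sum (I : Type) (r : seq I) (F : I -> T -> R) :
  (forall i, bounded_measurable (F i)) ->
  charge_integral nu (fun x => \sum_(i <- r) F i x) =
  \sum_(i <- r) charge_integral nu (F i).
Proof.
move=> bF; elim: r => [|i r IH].
  by rewrite big_nil; under eq_fun do rewrite big_nil; exact: charge_integral0.
under eq_fun do rewrite big_cons.
by rewrite big_cons charge_integralD ?IH//; exact: bm_sum.
Qed.

Lemma charge_integral_bounded_cvg (f_ : nat -> T -> R) f (M : R) :
  (forall n, measurable_fun setT (f_ n)) -> (forall n x, `|f_ n x| <= M) ->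
  (forall x, f_ ^~ x @ \oo --> f x) ->
  (fun n => charge_integral nu (f_ n)) @ \oo --> charge_integral nu f.
Proof.
move=> mf fM cf.
have hp := Rintegral_bounded_cvg (mu := mp) mf fM cf.
have hn := Rintegral_bounded_cvg (mu := mn) mf fM cf.
exact: (cvgB hp hn).
Qed.

(** On measurable sets this is the total variation of [nu]. *)
Definition charge_mass (A : set T) : R := fine (mp A) + fine (mn A).

Lemma charge_mass_ge0 A : 0 <= charge_mass A.
Proof. by rewrite addr_ge0// fine_ge0. Qed.

Lemma normr_charge_integral f (C : set T) (a b : R) : measurable C ->
  bounded_measurable f -> 0 <= a -> 0 <= b ->
  (forall x, `|f x| <= a) -> (forall x, C x -> `|f x| <= b) ->
  `|charge_integral nu f| <= b * charge_mass setT + a * charge_mass (~` C).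
Proof.
move=> mC bf a0 b0 fa fb; rewrite (le_trans (ler_normB _ _))//.
have hp := normr_Rintegral_split mp mC bf a0 b0 fa fb.
have hn := normr_Rintegral_split mn mC bf a0 b0 fa fb.
rewrite /charge_mass; lra.
Qed.

(** [charge_integral] is defined from one chosen Hahn decomposition; this frees it from the choice.
    Equality of [mp - mn] and [m1 - m2] is rewritten without subtraction, as equality of the
    measures [mp + m2] and [m1 + mn]. *)
Lemma charge_integralE (m1 m2 : {finite_measure set T -> \bar R}) f :
  (forall A, measurable A -> nu A = (m1 A - m2 A)%E) ->
  bounded_measurable f ->
  charge_integral nu f = Rintegral m1 setT f - Rintegral m2 setT f.
Proof.
move=> nuE bf.
have : (\int[measure_add mp m2]_x (f x)%:E = \int[measure_add m1 mn]_x (f x)%:E)%E.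
  apply: eq_measure_integral => A mA _.
  transitivity (mp A + m2 A)%E; first by rewrite -measure_addE.
  transitivity (m1 A + mn A)%E; last by rewrite -measure_addE.
  have := jordan_decomp (hahn_posneg nu) mA; rewrite nuE// /cadd/= cscaleN1/=.
  rewrite -(fineK (fin_num_measure m1 A mA)) -(fineK (fin_num_measure m2 A mA)).
  rewrite -(fineK (fin_num_measure mp A mA)) -(fineK (fin_num_measure mn A mA)).
  by rewrite -!EFinB -!EFinD => -[h]; congr EFin; lra.
rewrite !integral_measure_add//; try exact: bm_integrable.
have int_fin (m : {finite_measure set T -> \bar R}) :
    (\int[m]_x (f x)%:E = (Rintegral m setT f)%:E)%E.
  by rewrite /Rintegral fineK//; apply: integrable_fin_num => //; exact: bm_integrable.
by rewrite !int_fin -!EFinD /charge_integral => -[h]; lra.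
Qed.

End charge_integral_theory.

(** * Double integrals of positive definite kernels *)

Section borel_sets.
Context {R : realType} {X : topologicalType} (x0 : X).

Lemma open_borel (U : set (borel x0)) : open (U : set X) -> measurable U.
Proof. by move=> oU; apply: sub_sigma_algebra. Qed.

Lemma closed_borel (U : set (borel x0)) : closed (U : set X) -> measurable U.
Proof.
move=> cU; rewrite -(setCK U); apply: measurableC; apply: open_borel.
exact: (@closed_openC X U cU).
Qed.

Lemma continuous_borel (f : X -> R) : continuous f ->
  measurable_fun setT (f : borel x0 -> R).
Proof.
move=> cf; apply: (measurability _ (RGenOInfty.measurableE R)) => _ [_ [a ->] <-].
rewrite setTI; apply: open_borel.
rewrite set_itvE.
by move/continuousP : cf; apply; exact: (@open_gt R a).
Qed.

(* [x0] is only used as the base point of [based x0]. *)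
Lemma compact_finite_cover (C : set X) (U : X -> set X) : compact C ->
  (forall x, open (U x)) -> (forall x, C x -> U x x) ->
  exists s : seq X, forall x, C x -> exists2 y, y \in s & U y x.
Proof.
move=> cC oU CU; have cC' : compact (C : set (based x0)) by [].
rewrite compact_cover in cC'.
have [||D _ hD] := cC' X C U; first by move=> x _; exact: oU.
  by move=> x Cx; exists x => //; exact: CU.
by exists (finmap.enum_fset D) => x /hD [y yD Uyx]; exists y.
Qed.

(** The cover is made disjoint by sending each point to the first member of the list that contains
    it, [p] giving the centre of that member. Points covered by no member go to one extra index,
    whose centre [x0] is arbitrary. *)
Lemma finite_fibers_approx (U : X -> set X) (s : seq X) :
  (forall x, open (U x)) ->
  exists n (t : borel x0 -> 'I_n) (p : 'I_n -> X),
    (forall i, measurable [set x | t x = i]) /\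
    forall x, (exists2 y, y \in s & U y x) -> U (p (t x)) x.
Proof.
move=> oU; elim: s => [|y s [n [t [p [mt tp]]]]].
  exists 1%N, (fun=> ord0), (fun=> x0); split=> [i|x []//].
  by rewrite (_ : [set _ | _] = setT)//; apply/seteqP; split=> x //= _; rewrite !ord1.
exists n.+1, (fun x => if `[< U y x >] then ord0 else lift ord0 (t x)),
  (fun i => oapp p y (unlift ord0 i)).
have mU : measurable (U y : set (borel x0)) by exact: open_borel.
split=> [i|x [z]].
  have [j|] := unliftP ord0 i => ->.
    rewrite (_ : [set _ | _] = ~` (U y) `&` [set x | t x = j]).
      by apply: measurableI => //; exact: measurableC.
    apply/seteqP; split=> x /=.
      by case: asboolP => // nU /lift_inj.
    by move=> [nU <-]; rewrite asboolF.
  rewrite (_ : [set _ | _] = U y)//; apply/seteqP; split=> x /=.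
    by case: asboolP.
  by move=> Ux; rewrite asboolT.
case: asboolP => [Uyx _ _|nU]; first by rewrite unlift_none.
rewrite inE liftK/= => /orP[/eqP ->//|zs Uz]; apply: tp; by exists z.
Qed.

End borel_sets.

Section double_integral.
Context {R : realType} {X : topologicalType} (x0 : X).
Variable nu : {charge set (borel x0) -> \bar R}.
Hypothesis X_hausdorff : hausdorff_space X.
Hypothesis nu_tight : forall e : R, 0 < e ->
  exists2 C : set X, compact C & charge_mass nu (~` C) <= e.

Variables (P : X -> X -> R) (M : R).
Hypothesis P_pd : pd_kernel P.
Hypothesis P_cont : continuous (fun p : X * X => P p.1 p.2).
Hypothesis P_bounded : forall x, P x x <= M.

Lemma cont_slice y : continuous (P ^~ y).
Proof.
move=> x; apply: (@continuous_comp _ _ _ (fun x => (x, y)) (fun p => P p.1 p.2)).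
  by apply: cvg_pair; [exact: cvg_id|exact: cvg_cst].
exact: P_cont.
Qed.

Lemma cont_diag : continuous (fun x => P x x).
Proof.
move=> x; apply: (@continuous_comp _ _ _ (fun x => (x, x)) (fun p => P p.1 p.2)).
  by apply: cvg_pair; exact: cvg_id.
exact: P_cont.
Qed.

Lemma cont_pd_dist2 y : continuous (pd_dist2 P ^~ y).
Proof.
move=> x; apply: cvgB; last by apply: cvgM; [exact: cvg_cst|exact: cont_slice].
by apply: cvgD; [exact: cont_diag|exact: cvg_cst].
Qed.

Lemma pd_bounded x y : `|P x y| <= M.
Proof.
have M0 : 0 <= M by apply: le_trans (pd_ge0 x P_pd) (P_bounded x).
rewrite -(@ler_sqr _ _ M) ?nnegrE// real_normK ?num_real//.
rewrite (le_trans (pd_cauchy1 x y P_pd))// expr2.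
by apply: ler_pM => //; exact: pd_ge0.
Qed.

Lemma pd_slice_close x x' y e : 0 <= e -> M * pd_dist2 P x x' <= e ^+ 2 ->
  `|P x y - P x' y| <= e.
Proof.
move=> e0 h; rewrite -(@ler_sqr _ _ e) ?nnegrE// real_normK ?num_real//.
rewrite (le_trans (pd_cauchy2 x x' y P_pd))//.
by rewrite (le_trans _ h)// ler_wpM2r// pd_dist2_ge0.
Qed.

Lemma bm_slice y : bounded_measurable (P ^~ y : borel x0 -> R).
Proof.
split; first by apply: (continuous_borel (x0 := x0)); exact: cont_slice.
by exists M => x; exact: pd_bounded.
Qed.

Lemma pd_bound_ge0 (x : X) : 0 <= M.
Proof. exact: le_trans (pd_ge0 x P_pd) (P_bounded x). Qed.

Lemma normr_charge_integral_le (f : borel x0 -> R) a : bounded_measurable f ->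
  (forall x, `|f x| <= a) -> `|charge_integral nu f| <= a * charge_mass nu setT.
Proof.
move=> bf fa; have a0 : 0 <= a by apply: le_trans (fa x0); exact: normr_ge0.
have := @normr_charge_integral _ _ _ nu f setT a a measurableT bf a0 a0 fa
  (fun x _ => fa x).
by rewrite setCT /charge_mass !measure0/= addr0 mulr0 addr0.
Qed.

(** By Cauchy-Schwarz, slices at nearby points are uniformly close in the other variable, so the
    inner integral is continuous in [y], hence Borel. *)
Lemma bm_charge_integral_slice :
  bounded_measurable (fun y : borel x0 => charge_integral nu (P ^~ y : borel x0 -> R)).
Proof.
split; last first.
  exists (M * charge_mass nu setT) => y.
  by apply: normr_charge_integral_le; [exact: bm_slice|move=> x; exact: pd_bounded].
apply: (continuous_borel (x0 := x0)) => y.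
have M0 := pd_bound_ge0 x0; have V0 := charge_mass_ge0 nu setT.
apply/cvgrPdist_le => e e0; set V := charge_mass nu setT in V0.
(* The [+ 1] here and below keep the denominators positive when [V] or [M] is 0. *)
pose e1 := e / (V + 1); have e10 : 0 < e1 by rewrite divr_gt0// ltr_wpDl.
have : \forall y' \near y, pd_dist2 P y' y < e1 ^+ 2 / (M + 1).
  have := @cont_pd_dist2 y y; rewrite /continuous_at pd_dist2xx.
  by move=> /cvgr_lt; apply; rewrite divr_gt0 ?exprn_gt0// ltr_wpDl.
apply: filterS => y' hy'.
rewrite -charge_integralB; [|exact: bm_slice..].
apply: (@le_trans _ _ (e1 * V)); last first.
  by rewrite /e1 mulrAC ler_pdivrMr ?ltr_wpDl//; nra.
apply: normr_charge_integral_le; first by apply: bmB; exact: bm_slice.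
move=> x; rewrite (P_pd.1 x y) (P_pd.1 x y') distrC.
apply: pd_slice_close; first exact: ltW.
move: hy'; rewrite ltr_pdivlMr ?ltr_wpDl// => /ltW; apply: le_trans.
by rewrite mulrC ler_wpM2l ?lerDl// pd_dist2_ge0.
Qed.

(* A step function [t] replaces each point of a compact set that carries almost
   all the mass by one of finitely many points [p (t x)] that is close to it
   for the distance of the kernel; on such step functions the double integral
   is a finite quadratic form. *)
Lemma pd_double_integral_ge0 :
  0 <= charge_integral nu (fun y => charge_integral nu (P ^~ y : borel x0 -> R)).
Proof.
have M0 := pd_bound_ge0 x0; have V0 := charge_mass_ge0 nu setT.
set V := charge_mass nu setT in V0.
set I := charge_integral nu _.
(* The step kernel differs from [P] by at most [2 * e] on pairs of points of [C] and by at most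
   [2 * M] elsewhere, and the complement of [C] has mass at most [e]. Integrating twice gives the
   error [(2 * e * V + 2 * M * e) * V + 2 * M * V * e]. *)
suff h e : 0 < e -> - (e * (2 * V * V + 4 * M * V)) <= I.
  apply/ler_addgt0Pr => e e0; set K := 2 * V * V + 4 * M * V in h.
  have K0 : 0 <= K by rewrite /K addr_ge0// ?mulr_ge0.
  have := h (e / (K + 1)); rewrite divr_gt0 ?ltr_wpDl// => /(_ isT).
  have : e / (K + 1) * K <= e.
    by rewrite mulrAC ler_pdivrMr ?ltr_wpDl//; nra.
  lra.
move=> e0; have [C cC Ce] := nu_tight e0.
pose delta := e ^+ 2 / (M + 1).
pose U y := [set x | pd_dist2 P x y < delta].
have oU y : open (U y).
  have /continuousP/(_ _ (@open_lt R delta)) := @cont_pd_dist2 y.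
  by [].
have CU x : C x -> U x x.
  by move=> _; rewrite /U/= pd_dist2xx divr_gt0 ?exprn_gt0// ltr_wpDl.
have [s sC] := compact_finite_cover x0 cC oU CU.
have [n [t [p [mt tp]]]] := finite_fibers_approx x0 s oU.
have close x y : C x -> `|P x y - P (p (t x)) y| <= e.
  move=> Cx; apply: pd_slice_close; first exact: ltW.
  have /tp := sC x Cx; rewrite /U/= ltr_pdivlMr ?ltr_wpDl// => /ltW; apply: le_trans.
  by rewrite mulrC ler_wpM2l ?lerDl// pd_dist2_ge0.
pose E i : set (borel x0) := [set x | t x = i].
pose c i := charge_integral nu (\1_(E i)).
have bE i : bounded_measurable (\1_(E i) : borel x0 -> R).
  by apply: bm_indic; exact: mt.
have step (k : 'I_n -> R) :
    (fun x => k (t x)) = (fun x : borel x0 => \sum_i k i * \1_(E i) x).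
  apply/funext => x; rewrite (bigD1 (t x))//= big1 => [|i ti].
    by rewrite indicE mem_set// mulr1 addr0.
  by rewrite indicE memNset ?mulr0// /E/= => /esym/eqP; apply/negP.
have bstep (k : 'I_n -> R) : bounded_measurable (fun x : borel x0 => k (t x)).
  by rewrite step; apply: bm_sum => i; exact: bmZ.
have Lstep (k : 'I_n -> R) :
    charge_integral nu (fun x : borel x0 => k (t x)) = \sum_i k i * c i.
  rewrite step charge_integral_sum => [|i]; last exact: bmZ.
  by apply: eq_bigr => i _; rewrite charge_integralZ.
pose S (y : borel x0) := charge_integral nu (fun x : borel x0 => P (p (t x)) (p (t y))).
have bS : bounded_measurable S.
  exact: (bstep (fun j => charge_integral nu (fun x : borel x0 => P (p (t x)) (p j)))).
have LS : 0 <= charge_integral nu S.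
  rewrite /S (Lstep (fun j =>
    charge_integral nu (fun x : borel x0 => P (p (t x)) (p j)))).
  rewrite (eq_bigr (fun j => \sum_i c i * c j * P (p i) (p j))) => [|j _].
    by rewrite exchange_big; exact: P_pd.2.
  rewrite (Lstep (fun i => P (p i) (p j))) mulr_suml.
  by apply: eq_bigr => i _; ring.
have mC : measurable (C : set (borel x0)).
  by apply: closed_borel; exact: compact_closed.
have bP := bm_charge_integral_slice.
have P2M x y x' y' : `|P x y - P x' y'| <= 2 * M.
  by rewrite (le_trans (ler_normB _ _))// mulr_natl mulr2n lerD ?pd_bounded.
have : `|I - charge_integral nu S| <= (2 * e * V + 2 * M * e) * V + 2 * M * V * e.
  rewrite /I -charge_integralB//.
  have hV : 0 <= 2 * M * V by rewrite !mulr_ge0.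
  apply: le_trans.
    apply: (@normr_charge_integral _ _ _ nu _ C (2 * M * V)
      (2 * e * V + 2 * M * e)) => //.
    - exact: bmB.
    - by rewrite addr_ge0// !mulr_ge0// ltW.
    - move=> y.
      rewrite /S -charge_integralB;
        [|exact: bm_slice|exact: (bstep (fun i => P (p i) _))].
      apply: normr_charge_integral_le => //.
      by apply: bmB; [exact: bm_slice|exact: (bstep (fun i => P (p i) _))].
    - move=> y Cy.
      rewrite /S -charge_integralB;
        [|exact: bm_slice|exact: (bstep (fun i => P (p i) _))].
      apply: le_trans.
        apply: (@normr_charge_integral _ _ _ nu _ C (2 * M) (2 * e)) => //.
        + by apply: bmB; [exact: bm_slice|exact: (bstep (fun i => P (p i) _))].
        + by rewrite mulr_ge0.
        + by rewrite mulr_ge0// ltW.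
        (* The two variables are replaced one at a time; symmetry turns the second replacement into
           one of the first variable. *)
        + move=> x Cx; rewrite (_ : _ - _ = (P x y - P (p (t x)) y) +
             (P y (p (t x)) - P (p (t y)) (p (t x)))).
            by rewrite (le_trans (ler_normD _ _))// mulr_natl mulr2n lerD ?close.
          by rewrite (P_pd.1 y) (P_pd.1 (p (t y))); ring.
      by rewrite lerD2l ler_wpM2l// mulr_ge0.
  by rewrite lerD2l ler_wpM2l.
rewrite ler_norml => /andP[+ _]; nra.
Qed.

End double_integral.

(** * Separation of compact sets by functions with vanishing integral *)

Section trigonometric_algebra.
Context d (T : measurableType d) (R : realType).
Variables (nu : {charge set T -> \bar R}) (W : T -> R).
Hypothesis bW : bounded_measurable W.
Implicit Types f g F G : T -> R.

Let L f : R := charge_integral nu (fun x => W x * f x).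

Let LD f g : bounded_measurable f -> bounded_measurable g ->
  L (fun x => f x + g x) = L f + L g.
Proof.
move=> bf bg; rewrite /L -charge_integralD; [|exact: bmM..].
by congr charge_integral; apply/funext => x; rewrite mulrDr.
Qed.

Let LZ a f : bounded_measurable f -> L (fun x => a * f x) = a * L f.
Proof.
move=> bf; rewrite /L -charge_integralZ; last exact: bmM.
by congr charge_integral; apply/funext => x; rewrite mulrCA.
Qed.

Let L_cvg (f_ : nat -> T -> R) f (M : R) :
  (forall n, measurable_fun setT (f_ n)) -> (forall n x, `|f_ n x| <= M) ->
  (forall x, f_ ^~ x @ \oo --> f x) -> L \o f_ @ \oo --> L f.
Proof.
move=> mf fM cf; have [mW [N WN]] := bW.
apply: (charge_integral_bounded_cvg (M := N * M)) => [n|n x|x].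
- exact: measurable_funM.
- by rewrite normrM ler_pM.
- by apply: cvgM; [exact: cvg_cst|exact: cf].
Qed.

Variable V : set (T -> R).
Hypothesis V_meas : forall F, V F -> measurable_fun setT F.
Hypothesis V_cst : forall a, V (fun=> a).
Hypothesis V_add : forall F G, V F -> V G -> V (fun x => F x + G x).
Hypothesis V_opp : forall F, V F -> V (fun x => - F x).
Hypothesis V_cos : forall F, V F -> L (cos \o F) = 0.

Lemma bm_cos F : measurable_fun setT F -> bounded_measurable (cos \o F).
Proof.
move=> mF; split; last by exists 1 => x; rewrite /= ler_norml cos_geN1 cos_le1.
apply: measurableT_comp => //; apply: continuous_measurable_fun; exact: continuous_cos.
Qed.

Definition annihilated f : Prop :=
  bounded_measurable f /\ forall F, V F -> L (fun x => f x * cos (F x)) = 0.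

(** The annihilator is linear and closed under bounded limits, but nothing makes it closed under
    products; its multipliers are closed under all three. *)
Definition stabilizer f : Prop :=
  bounded_measurable f /\ forall g, annihilated g -> annihilated (fun x => f x * g x).

Lemma annihilatedD f g : annihilated f -> annihilated g ->
  annihilated (fun x => f x + g x).
Proof.
move=> [bf hf] [bg hg]; split=> [|F VF]; first exact: bmD.
under eq_fun do rewrite mulrDl.
have bc := bm_cos (V_meas VF).
rewrite LD ?hf ?hg ?addr0//; exact: bmM.
Qed.

Lemma annihilatedZ a f : annihilated f -> annihilated (fun x => a * f x).
Proof.
move=> [bf hf]; split=> [|F VF]; first exact: bmZ.
under eq_fun do rewrite -mulrA.
by rewrite LZ ?hf ?mulr0//; apply: bmM => //; exact: bm_cos (V_meas VF).
Qed.

Lemma annihilated_cvg (f_ : nat -> T -> R) f (M : R) :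
  (forall n, annihilated (f_ n)) -> (forall n x, `|f_ n x| <= M) ->
  (forall x, f_ ^~ x @ \oo --> f x) -> annihilated f.
Proof.
move=> hf fM cf; split=> [|F VF].
  by apply: (bm_cvg _ fM cf) => n; exact: (hf n).1.1.
have : L \o (fun n x => f_ n x * cos (F x)) @ \oo --> L (fun x => f x * cos (F x)).
  have bc := bm_cos (V_meas VF); apply: (L_cvg (M := M * 1)) => [n|n x|x].
  - by apply: measurable_funM; [exact: (hf n).1.1|exact: bc.1].
  - by rewrite normrM ler_pM// ler_norml cos_geN1 cos_le1.
  - by apply: cvgM; [exact: cf|exact: cvg_cst].
have -> : L \o (fun n x => f_ n x * cos (F x)) = fun=> 0.
  by apply/funext => n /=; exact: (hf n).2.
by move=> /(cvg_unique (@Rhausdorff R) (cvg_cst 0)) <-.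
Qed.

Lemma stabilizerD f g : stabilizer f -> stabilizer g -> stabilizer (fun x => f x + g x).
Proof.
move=> [bf hf] [bg hg]; split=> [|h Ah]; first exact: bmD.
by under eq_fun do rewrite mulrDl; apply: annihilatedD; [exact: hf|exact: hg].
Qed.

Lemma stabilizerZ a f : stabilizer f -> stabilizer (fun x => a * f x).
Proof.
move=> [bf hf]; split=> [|h Ah]; first exact: bmZ.
by under eq_fun do rewrite -mulrA; apply: annihilatedZ; exact: hf.
Qed.

Lemma stabilizerM f g : stabilizer f -> stabilizer g -> stabilizer (fun x => f x * g x).
Proof.
move=> [bf hf] [bg hg]; split=> [|h Ah]; first exact: bmM.
by under eq_fun do rewrite -mulrA; apply: hf; exact: hg.
Qed.

Lemma stabilizer_cst a : stabilizer (fun=> a).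
Proof. by split=> [|g Ag]; [exact: bm_cst|exact: annihilatedZ]. Qed.

Lemma stabilizerX f n : stabilizer f -> stabilizer (fun x => f x ^+ n).
Proof.
move=> hf; elim: n => [|n IH].
  by under eq_fun do rewrite expr0; exact: stabilizer_cst.
by under eq_fun do rewrite exprS; exact: stabilizerM.
Qed.

Lemma stabilizerB f g : stabilizer f -> stabilizer g -> stabilizer (fun x => f x - g x).
Proof.
move=> hf hg; under eq_fun do rewrite -mulN1r.
by apply: stabilizerD => //; exact: stabilizerZ.
Qed.

Lemma stabilizer_cvg (f_ : nat -> T -> R) f (M : R) :
  (forall n, stabilizer (f_ n)) -> (forall n x, `|f_ n x| <= M) ->
  (forall x, f_ ^~ x @ \oo --> f x) -> stabilizer f.
Proof.
move=> hf fM cf; split=> [|g Ag].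
  by apply: (bm_cvg _ fM cf) => n; exact: (hf n).1.1.
have [_ [N gN]] := Ag.1.
apply: (annihilated_cvg (f_ := fun n x => f_ n x * g x) (M := M * N)) => [n|n x|x].
- exact: (hf n).2.
- by rewrite normrM ler_pM.
- by apply: cvgM; [exact: cf|exact: cvg_cst].
Qed.

(** Since [cos F * cos G] is half the sum of the cosines of [G + F] and [G - F], it suffices that
    [V] is an additive group. *)
Lemma stabilizer_cos F : V F -> stabilizer (cos \o F).
Proof.
move=> VF; split=> [|g [bg hg]]; first exact: bm_cos (V_meas VF).
have bc H : V H -> bounded_measurable (fun x => cos (H x)).
  by move=> VH; exact: bm_cos (V_meas VH).
split=> [|G VG]; first by apply: bmM => //; exact: bc.
have VD := V_add VG VF; have VB := V_add VG (V_opp VF).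
rewrite (_ : (fun x => _) = (fun x => 2^-1 * (g x * cos (G x + F x)) +
    2^-1 * (g x * cos (G x + - F x)))).
  rewrite LD; [|by apply: bmZ; apply: bmM => //; exact: bc..].
  rewrite !LZ; [|by apply: bmM => //; exact: bc..].
  by rewrite (hg _ VD) (hg _ VB) mulr0 addr0.
apply/funext => x /=; rewrite !cosD cosN sinN; by field.
Qed.

(** The constant 1 is annihilated, so its multiple [f] is too; test [f] against the cosine of the
    zero function. *)
Lemma stabilizer_integral0 f : stabilizer f -> L f = 0.
Proof.
move=> [_ hf]; have : annihilated (fun=> 1).
  split=> [|F VF]; first exact: bm_cst.
  by under eq_fun do rewrite mul1r; exact: V_cos.
move=> /hf[_ /(_ _ (V_cst 0))].
by under eq_fun do rewrite cos0 !mulr1.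
Qed.

(* The iteration [p := p + (t^2 - p^2) / 2] increases to [|t|] on [-1, 1]. *)
Lemma stabilizer_norm_le1 f : stabilizer f -> (forall x, `|f x| <= 1) ->
  stabilizer (fun x => `|f x|).
Proof.
move=> hf f1.
pose p := fix p n x := if n is m.+1 then p m x + 2^-1 * (f x ^+ 2 - p m x ^+ 2) else 0.
have p_bound n x : 0 <= p n x /\
    0 <= `|f x| - p n x <= `|f x| * (1 - `|f x| / 2) ^+ n.
  have t0 := normr_ge0 (f x); have t1 := f1 x.
  elim: n => [|n [p0 /andP[q0 q1]]] /=; first by rewrite expr0 subr0 mulr1 !lexx t0.
  rewrite -(real_normK (num_real (f x))); move: t0 t1 p0 q0 q1.
  set t := `|f x|; set q := p n x; set u := (1 - t / 2) ^+ n => t0 t1 p0 q0 q1.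
  (* Each iteration multiplies the error by [1 - (t + q) / 2], which is at most [1 - t / 2]:
     geometric decay if [t > 0], and the bound is 0 if [t = 0]. *)
  have -> : t - (q + 2^-1 * (t ^+ 2 - q ^+ 2)) = (t - q) * (1 - (t + q) / 2) by field.
  split; first by rewrite addr_ge0// mulr_ge0// subr_sqr mulr_ge0// addr_ge0.
  apply/andP; split; first by rewrite mulr_ge0//; lra.
  rewrite exprSr mulrA; apply: ler_pM => //; lra.
apply: (stabilizer_cvg (f_ := p) (M := 1)) => [n|n x|x].
- elim: n => [|n IH] /=; first exact: stabilizer_cst.
  apply: stabilizerD => //; apply: stabilizerZ; apply: stabilizerB; exact: stabilizerX.
- have [p0 /andP[q0 _]] := p_bound n x; have := f1 x.
  by rewrite (ger0_norm p0); lra.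
- have t0 := normr_ge0 (f x); have t1 := f1 x.
  have c0 : (fun n => `|f x| * (1 - `|f x| / 2) ^+ n) @ \oo --> (0 : R).
    have [->|fx0] := eqVneq `|f x| 0.
      by under eq_fun do rewrite mul0r; exact: cvg_cst.
    have fx : 0 < `|f x| by rewrite lt_neqAle eq_sym fx0.
    rewrite -[X in _ --> X](mulr0 `|f x|); apply: cvgM; first exact: cvg_cst.
    by apply: cvg_expr; rewrite ger0_norm; lra.
  have : (fun n => `|f x| - p n x) @ \oo --> (0 : R).
    apply: (squeeze_cvgr _ (cvg_cst 0) c0).
    by apply: nearW => n; exact: (p_bound n x).2.
  move=> /(cvgB (cvg_cst `|f x|)); rewrite subr0.
  rewrite (_ : _ - _ = p ^~ x)//; apply/funext => n; exact: subKr.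
Qed.

Lemma stabilizer_norm f : stabilizer f -> stabilizer (fun x => `|f x|).
Proof.
move=> hf; have [_ [M fM]] := hf.1.
pose N := `|M| + 1; have N0 : 0 < N by rewrite ltr_wpDl.
have : stabilizer (fun x => `|N^-1 * f x|).
  apply: stabilizer_norm_le1 => [|x]; first exact: stabilizerZ.
  rewrite normrM gtr0_norm ?invr_gt0// mulrC ler_pdivrMr// mul1r.
  by rewrite (le_trans (fM x))// /N (le_trans (ler_norm M))// lerDl.
move=> /(stabilizerZ N); congr stabilizer; apply/funext => x.
by rewrite normrM gtr0_norm ?invr_gt0// mulVKf// gt_eqF.
Qed.

(** [g] is the positive part of [f] scaled into [0, 1], and [1 - (1 - g) ^+ n] tends to 1 where
    [g > 0] and stays 0 where [g = 0]. *)
Lemma stabilizer_indic_gt0 f : stabilizer f -> stabilizer (\1_[set x | 0 < f x]).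
Proof.
move=> hf; have [_ [M fM]] := hf.1.
pose N := `|M| + 1; have N0 : 0 < N by rewrite ltr_wpDl.
pose g x := (2 * N)^-1 * (f x + `|f x|).
have hg : stabilizer g.
  by apply: stabilizerZ; apply: stabilizerD => //; exact: stabilizer_norm.
have fN x : `|f x| <= N.
  by rewrite (le_trans (fM x))// /N (le_trans (ler_norm M))// lerDl.
have g01 x : 0 <= g x <= 1.
  rewrite /g mulrC pmulr_lge0 ?invr_gt0 ?mulr_gt0// ler_pdivrMr ?mulr_gt0// mul1r.
  by have := fN x; case: (ger0P (f x)) => ?; lra.
apply: (stabilizer_cvg (f_ := fun n x => 1 - (1 - g x) ^+ n) (M := 1)) => [n|n x|x].
- apply: stabilizerB; first exact: stabilizer_cst.
  by apply: stabilizerX; apply: stabilizerB => //; exact: stabilizer_cst.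
- have /andP[g0 g1] := g01 x.
  have h0 : 0 <= (1 - g x) ^+ n by rewrite exprn_ge0//; lra.
  have h1 : (1 - g x) ^+ n <= 1 by rewrite exprn_ile1//; lra.
  by rewrite ger0_norm; lra.
- have /andP[g0 g1] := g01 x; rewrite indicE.
  have [fx|fx] := ltP 0 (f x).
    rewrite mem_set//=; rewrite -[X in _ --> X](subr0 1).
    apply: cvgB; first exact: cvg_cst.
    have gx : 0 < g x by rewrite /g mulr_gt0 ?invr_gt0 ?mulr_gt0// gtr0_norm// addr_gt0.
    by apply: cvg_expr; rewrite ger0_norm; lra.
  rewrite memNset/=; last by rewrite ltNge fx.
  have -> : g x = 0 by rewrite /g ler0_norm// subrr mulr0.
  by under eq_fun do rewrite subr0 expr1n subrr; exact: cvg_cst.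
Qed.

Definition stable_set (A : set T) : Prop := stabilizer (\1_A).

Lemma stable_setT : stable_set setT.
Proof.
rewrite /stable_set (_ : \1_setT = fun=> 1); first exact: stabilizer_cst.
by apply/funext => x; rewrite indicE in_setT.
Qed.

Lemma stable_setI A B : stable_set A -> stable_set B -> stable_set (A `&` B).
Proof.
move=> hA hB; rewrite /stable_set (_ : \1_(A `&` B) = fun x => \1_A x * \1_B x).
  exact: stabilizerM.
by rewrite indicI.
Qed.

Lemma stable_setC A : stable_set A -> stable_set (~` A).
Proof.
move=> hA; rewrite /stable_set (_ : \1_(~` A) = fun x => 1 - \1_A x).
  by apply: stabilizerB => //; exact: stabilizer_cst.
by apply/funext => x; rewrite !indicE in_setC; case: (x \in A); rewrite ?subrr ?subr0.
Qed.

Lemma stable_set_measurable A : stable_set A -> measurable A.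
Proof.
move=> [[mA _] _]; have := mA measurableT [set 1] (measurable_set1 1).
rewrite setTI (_ : _ @^-1` _ = A)//; apply/seteqP; split=> x /=.
  rewrite indicE; case: (boolP (x \in A)) => [/set_mem//|_ /= /eqP].
  by rewrite eq_sym oner_eq0.
by move=> Ax; rewrite indicE mem_set.
Qed.

(** The sine is the cosine shifted by [pi / 2], and [V] contains the constants. *)
Lemma stable_sin_gt0 F : V F -> stable_set [set x | 0 < sin (F x)].
Proof.
move=> VF; have := stabilizer_indic_gt0 (stabilizer_cos (V_add VF (V_cst (- (pi / 2))))).
rewrite /stable_set; congr (stabilizer (\1_ _)).
by apply/seteqP; split=> x /=;
  rewrite cosD cosN sinN cos_pihalf sin_pihalf mulr0 add0r mulrN opprK mulr1.
Qed.

End trigonometric_algebra.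

(** * Separation of disjoint compact sets within a Boolean algebra of sets *)

Section compact_separation.
Context {X : topologicalType} (x0 : X) (S : set (set X)).
Hypothesis S_setT : S setT.
Hypothesis S_setI : forall A B, S A -> S B -> S (A `&` B).
Hypothesis S_setC : forall A, S A -> S (~` A).
Hypothesis S_sep : forall x y, x <> y -> exists A B,
  [/\ open A, open B, S A, A `&` B = set0 & A x /\ B y].

(** The usual double compactness argument: finite intersections separate a point from [C'], then
    finite unions cover [C]. Only the sets around [C] must lie in [S]; those around [C'] only serve
    to extract the cover. *)
Lemma separate_compacts (C C' : set X) : compact C -> compact C' ->
  C `&` C' = set0 -> exists U, [/\ S U, C `<=` U & U `&` C' = set0].
Proof.
move=> cC cC' CC'.
have sep_point x : exists AB : set X * set X,
    [/\ open AB.1, S AB.1, C' `<=` AB.2, AB.1 `&` AB.2 = set0 & C x -> AB.1 x].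
  have : forall y, exists AB : set X * set X, [/\ open AB.1, open AB.2,
      S AB.1, AB.1 `&` AB.2 = set0 & AB.1 x /\ (x <> y -> AB.2 y)].
    move=> y; have [<-|/S_sep[A [B [oA oB SA AB [Ax By]]]]] := pselect (x = y).
      (* A dummy pair, so that the choice function is defined for every [y]; likewise below for [x]
         outside [C]. *)
      by exists (setT, set0); split=> //=; [exact: openT|exact: open0|rewrite setI0].
    by exists (A, B).
  move=> /choice[AB hAB].
  have [nCx|Cx] := pselect (C x); last first.
    exists (set0, setT); split=> //=; [exact: open0| |by rewrite set0I].
    by rewrite -setCT; exact: S_setC.
  have nC'x : ~ C' x by move=> C'x; have : (C `&` C') x by []; rewrite CC'.
  have oAB y : open (AB y).2 by case: (hAB y).
  have ABy y : C' y -> (AB y).2 y.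
    by move=> C'y; have [_ _ _ _ [_]] := hAB y; apply=> e; apply: nC'x; rewrite e.
  have [s hs] := compact_finite_cover x0 cC' oAB ABy.
  suff [A [oA SA Ax Ad]] : exists A, [/\ open A, S A, A x &
      forall y, y \in s -> A `&` (AB y).2 = set0].
    exists (A, \bigcup_(y in [set` s]) (AB y).2); split=> //=.
    by rewrite setI_bigcupr; apply: bigcup0 => y; exact: Ad.
  elim: s {hs} => [|y s [A [oA SA Ax Ad]]].
    by exists setT; split=> //; exact: openT.
  have [oy _ Sy disj [xy _]] := hAB y.
  exists (A `&` (AB y).1); split=> //; [exact: openI|exact: S_setI|].
  move=> z; rewrite inE => /orP[/eqP ->|/Ad Az].
    by rewrite -setIA disj setI0.
  by rewrite setIAC Az set0I.
have [AB hAB] := choice sep_point.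
have oAB x : open (AB x).1 by case: (hAB x).
have ABx x : C x -> (AB x).1 x by case: (hAB x).
have [s hs] := compact_finite_cover x0 cC oAB ABx.
suff [U [SU Us UC]] : exists U, [/\ S U, forall x, x \in s -> (AB x).1 `<=` U &
    U `&` C' = set0].
  by exists U; split=> // x /hs[y ys]; exact: Us.
elim: s {hs} => [|y s [U [SU Us UC]]].
  by exists set0; split=> //; [rewrite -setCT; exact: S_setC|rewrite set0I].
have [_ Sy C'y ABy _] := hAB y.
exists (~` (~` U `&` ~` (AB y).1)); split=> [||].
- by apply: S_setC; apply: S_setI; exact: S_setC.
- rewrite setCI !setCK => z; rewrite inE => /orP[/eqP ->|/Us h] w Aw; first by right.
  by left; exact: h.
rewrite setCI !setCK setIUl UC set0U; apply/seteqP; split=> // w [Aw /C'y Bw].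
by have : ((AB y).1 `&` (AB y).2) w by []; rewrite ABy.
Qed.

End compact_separation.

(** * Mutually singular inner regular measures *)

Section zero_measure.
Context {R : realType} {X : topologicalType} (x0 : X).
Hypothesis X_hausdorff : hausdorff_space X.
Variable W : X -> R.
Hypothesis bW : bounded_measurable (W : borel x0 -> R).
Hypothesis W_gt0 : forall x, 0 < W x.

Definition inner_regular (m : set (borel x0) -> \bar R) : Prop :=
  forall (E : set (borel x0)) (e : R), measurable E -> 0 < e ->
  exists C : set X, [/\ compact C, C `<=` E & (m (E `\` C) <= e%:E)%E].

(** For compact [C] in [S1], take a compact [C'] in [S2] missing at most [e] of the mass of [m2],
    and [U] separating them. The integral of [W] over [C] for [m1] is at most that over [U], equal
    to the one for [m2], hence at most [M * e]. As [W > 0], [C] is null for [m1], and inner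
    regularity extends this to [S1]. *)
Lemma mutually_singular_eq0 (m1 m2 : {finite_measure set (borel x0) -> \bar R})
    (S1 S2 : set (borel x0)) :
  measurable S1 -> measurable S2 -> S1 `&` S2 = set0 ->
  m1 (~` S1) = 0%E -> m2 (~` S2) = 0%E -> inner_regular m1 -> inner_regular m2 ->
  (forall C C' : set X, compact C -> compact C' -> C `&` C' = set0 ->
    exists U : set (borel x0), [/\ measurable U, C `<=` U, U `&` C' = set0 &
      Rintegral m1 setT (fun x => W x * \1_U x) =
      Rintegral m2 setT (fun x => W x * \1_U x)]) ->
  m1 setT = 0%E.
Proof.
move=> mS1 mS2 S12 m1S1 m2S2 r1 r2 sep.
have mcompact C : compact C -> measurable (C : set (borel x0)).
  by move=> cC; apply: closed_borel; exact: compact_closed.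
have [mW [M WM]] := bW.
have M0 : 0 <= M by apply: le_trans (WM x0).
have bWU U : measurable U -> bounded_measurable (fun x : borel x0 => W x * \1_U x).
  by move=> mU; apply: bmM => //; exact: bm_indic.
have m1C (C : set X) : compact C -> C `<=` S1 -> m1 C = 0%E.
  move=> cC CS1; have mC := mcompact C cC.
  have small (e : R) : 0 < e -> Rintegral m1 setT (fun x => W x * \1_C x) <= M * e.
    move=> e0; have [C' [cC' C'S2 C'e]] := r2 S2 e mS2 e0.
    have mC' := mcompact C' cC'.
    have CC' : C `&` C' = set0.
      apply/seteqP; split=> // x [/CS1 xS1 /C'S2 xS2].
      by have : (S1 `&` S2) x by []; rewrite S12.
    have [U [mU CU UC' eqU]] := sep C C' cC cC' CC'.
    apply: (@le_trans _ _ (Rintegral m1 setT (fun x => W x * \1_U x))).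
      apply: le_Rintegral => //; [exact: bm_integrable (bWU _ _)..|] => x _.
      rewrite ler_wpM2l ?(ltW (W_gt0 x))// !indicE.
      case: (boolP (x \in C)) => [/set_mem/CU Ux|_]; first by rewrite mem_set.
      by case: (x \in U).
    rewrite eqU; apply: (@le_trans _ _ (Rintegral m2 setT (fun x => M * \1_U x))).
      apply: le_Rintegral => //; [exact: bm_integrable (bWU _ _)| |].
        by apply: bm_integrable; apply: bmZ; exact: bm_indic.
      move=> x _; rewrite ler_wpM2r ?indicE// (le_trans (ler_norm _))//.
    rewrite RintegralZl//; last by apply: bm_integrable; exact: bm_indic.
    rewrite /Rintegral integral_indic// setIT ler_wpM2l//.
    rewrite -lee_fin fineK; last exact: fin_num_measure.
    apply: (@le_trans _ _ (m2 (~` S2 `|` (S2 `\` C')))).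
      apply: le_measure; rewrite ?inE//.
        by apply: measurableU; [exact: measurableC|exact: measurableD].
      move=> x Ux; have [xS2|] := pselect (S2 x); last by left.
      right; split=> // C'x; have : (U `&` C') x by []; by rewrite UC'.
    apply: (@le_trans _ _ (m2 (~` S2) + m2 (S2 `\` C'))%E).
      by apply: measureU2; [exact: measurableC|exact: measurableD].
    by rewrite m2S2 add0e.
  have int0 : Rintegral m1 setT (fun x => W x * \1_C x) = 0.
    apply/eqP; rewrite eq_le Rintegral_ge0 ?andbT => [|x _]; last first.
      by rewrite mulr_ge0 ?(ltW (W_gt0 x))// indicE.
    apply/ler_addgt0Pr => e e0; rewrite add0r.
    apply: le_trans (small (e / (M + 1)) _) _; first by rewrite divr_gt0// ltr_wpDl.
    by rewrite mulrCA ler_piMr ?(ltW e0)// ler_pdivrMr ?ltr_wpDl// mul1r lerDl.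
  have mWC : measurable_fun (C : set (borel x0)) (EFin \o (W : borel x0 -> R)).
    by apply/measurable_EFinP; exact: measurable_funTS.
  have intC : (\int[m1]_(x in (C : set (borel x0))) `|(EFin \o W) x| = 0)%E.
    rewrite -[RHS](congr1 EFin int0) /Rintegral fineK; last first.
      by apply: integrable_fin_num => //; exact: bm_integrable (bWU _ _).
    rewrite [LHS]integral_mkcond; apply: eq_integral => x _.
    rewrite patchE indicE; case: (x \in _); rewrite ?mulr1 ?mulr0//=.
    by rewrite gtr0_norm.
  (* [W] vanishes almost everywhere on [C] but is positive everywhere, so [C] lies in the null set
     [N]. *)
  have [/(_ intC) [N [mN N0 hN]] _] := ae_eq_integral_abs m1 mC mWC.
  apply/eqP; rewrite eq_le measure_ge0 andbT -N0.
  apply: le_measure; rewrite ?inE//; apply: subset_trans hN => x Cx /= /(_ Cx) [].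
  by move=> Wx0; have := W_gt0 x; rewrite Wx0 ltxx.
apply/eqP; rewrite eq_le measure_ge0 andbT.
apply/lee_addgt0Pr => e e0; rewrite add0e.
have [C [cC CS1 Ce]] := r1 S1 e mS1 e0.
have mC := mcompact C cC.
apply: (@le_trans _ _ (m1 ((~` S1 `|` C) `|` (S1 `\` C)))).
  apply: le_measure; rewrite ?inE//.
    apply: measurableU; last exact: measurableD.
    by apply: measurableU => //; exact: measurableC.
  move=> x _; have [xS|] := pselect (S1 x); last by left; left.
  by have [xC|xC] := pselect (C x); [left; right|right].
apply: (@le_trans _ _ (m1 (~` S1 `|` C) + m1 (S1 `\` C))%E).
  apply: measureU2; last exact: measurableD.
  by apply: measurableU => //; exact: measurableC.
apply: (@le_trans _ _ (m1 (~` S1) + m1 C + m1 (S1 `\` C))%E).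
  by rewrite leeD2r//; apply: measureU2 => //; exact: measurableC.
by rewrite m1S1 (m1C C)// !add0e.
Qed.

End zero_measure.

(** * Radon charges annihilated by the kernel *)

Section dominated.
Context {R : realType} {X : topologicalType} (x0 : X).
Variable nu : {charge set (borel x0) -> \bar R}.
Hypothesis X_hausdorff : hausdorff_space X.
Hypothesis nu_tight : forall e : R, 0 < e ->
  exists2 C : set X, compact C & charge_mass nu (~` C) <= e.
Variables (K : X -> X -> R) (M : R).
Hypothesis K_pd : pd_kernel K.
Hypothesis K_cont : continuous (fun p : X * X => K p.1 p.2).
Hypothesis K_bounded : forall x, K x x <= M.
Hypothesis K_null :
  charge_integral nu (fun y => charge_integral nu (K ^~ y : borel x0 -> R)) = 0.

Lemma dominated_bounded (c : R) (G : X -> R) x : 0 <= c ->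
  pd_kernel (fun x y => c * K x y - G x * G y) -> G x ^+ 2 <= c * M.
Proof.
move=> c0 /(pd_ge0 x); rewrite subr_ge0 -expr2 => /le_trans; apply.
exact: ler_wpM2l.
Qed.

Lemma dominated_bm (c : R) (G : X -> R) : 0 <= c -> continuous G ->
  pd_kernel (fun x y => c * K x y - G x * G y) ->
  bounded_measurable (G : borel x0 -> R).
Proof.
move=> c0 cG hG; split; first exact: (continuous_borel (x0 := x0)).
exists (c * M + 1) => x; have := dominated_bounded x c0 hG.
rewrite -(real_normK (num_real (G x))).
have := normr_ge0 (G x); set t := `|G x|; nra.
Qed.

(** By [K_null], the double integral of [c * K - G G] is minus the square of the integral of [G]; it
    is also nonnegative, the kernel being positive definite. *)
Lemma dominated_integral0 (c : R) (G : X -> R) : 0 <= c -> continuous G ->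
  pd_kernel (fun x y => c * K x y - G x * G y) ->
  charge_integral nu (G : borel x0 -> R) = 0.
Proof.
move=> c0 cG hG; have bG := dominated_bm c0 cG hG.
have bK y : bounded_measurable (K ^~ y : borel x0 -> R).
  exact: (bm_slice x0 K_pd K_cont K_bounded).
have bIK := bm_charge_integral_slice nu K_pd K_cont K_bounded.
have := @pd_double_integral_ge0 _ _ x0 nu X_hausdorff nu_tight _ (c * M) hG.
set L := charge_integral nu G => h.
suff : 0 <= - L ^+ 2.
  by rewrite oppr_ge0 => L2; apply/eqP; rewrite -sqrf_eq0 eq_le L2 sqr_ge0.
have {h} : 0 <= charge_integral nu (fun y => charge_integral nu
     ((fun x => c * K x y - G x * G y) : borel x0 -> R)).
  apply: h => [p|x].
    apply: cvgB; first by apply: cvgM; [exact: cvg_cst|exact: K_cont].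
    apply: cvgM.
      by apply: (@continuous_comp _ _ _ fst G); [exact: cvg_fst|exact: cG].
    by apply: (@continuous_comp _ _ _ snd G); [exact: cvg_snd|exact: cG].
  rewrite (le_trans _ (ler_wpM2l c0 (K_bounded x)))//.
  by rewrite gerBl -expr2 sqr_ge0.
rewrite (_ : (fun y => _) = (fun y : borel x0 =>
    c * charge_integral nu (K ^~ y : borel x0 -> R) - L * G y)).
  rewrite charge_integralB; [|exact: bmZ..].
  by rewrite !charge_integralZ// K_null mulr0 add0r -/L expr2.
apply/funext => y; rewrite charge_integralB; [|exact: bmZ|].
  rewrite charge_integralZ//; congr (_ - _).
  rewrite mulrC -charge_integralZ//; congr charge_integral.
  by apply/funext => x; rewrite mulrC.
by under eq_fun do rewrite mulrC; exact: bmZ.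
Qed.

End dominated.

(** * Charges with vanishing double integral against the exponential kernel *)

Section gaussian_kernel.
Context {R : realType} {X : topologicalType} (x0 : X).
Variables (g : X -> X -> R).
Hypothesis X_hausdorff : hausdorff_space X.
Hypothesis g_cont : continuous (fun p : X * X => g p.1 p.2).
Hypothesis g_cnd : cond_neg_def g.
Variable m : R.
Hypothesis g_lb : forall x, m <= g x x.
Hypothesis g_metr : metrizable g.
Variable nu : {charge set (borel x0) -> \bar R}.
Hypothesis nu_tight : forall e : R, 0 < e ->
  exists2 C : set X, compact C & charge_mass nu (~` C) <= e.
Hypothesis K_null : charge_integral nu (fun y =>
  charge_integral nu ((fun x => expR (- g x y)) : borel x0 -> R)) = 0.

Let k := pd_of_cnd g x0.
Let W x := expR (g x0 x0 / 2 - g x x0).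

Let k_pd : pd_kernel k. Proof. exact: pd_of_cnd_pd. Qed.

Let g_slice y : continuous (g ^~ y).
Proof.
move=> x; apply: (@continuous_comp _ _ _ (fun x => (x, y)) (fun p => g p.1 p.2)).
  by apply: cvg_pair; [exact: cvg_id|exact: cvg_cst].
exact: g_cont.
Qed.

Let W_cont : continuous W.
Proof.
move=> x; apply: (@continuous_comp _ _ _ (fun x => g x0 x0 / 2 - g x x0) expR).
  by apply: cvgB; [exact: cvg_cst|exact: g_slice].
exact: continuous_expR.
Qed.

Let k_slice y : continuous (k ^~ y).
Proof.
move=> x; apply: cvgB; last exact: cvg_cst.
apply: cvgB; last exact: g_slice.
by apply: cvgD; [exact: g_slice|exact: cvg_cst].
Qed.

Let K_cont : continuous (fun p : X * X => expR (- g p.1 p.2)).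
Proof.
move=> p; apply: (@continuous_comp _ _ _ (fun p : X * X => - g p.1 p.2) expR).
  by apply: cvgN; exact: g_cont.
exact: continuous_expR.
Qed.

Let K_bounded x : expR (- g x x) <= expR (- m).
Proof. by rewrite ler_expR lerN2. Qed.

Let K_diag x : W x ^+ 2 * expR (k x x) <= expR (- m).
Proof. by rewrite expr2 -expN_pd_of_cnd. Qed.

(* The continuous functions of the reproducing kernel space of [k]. *)
Let V (F : X -> R) : Prop := continuous F /\
  exists2 C, 0 <= C & pd_kernel (fun x y => C * k x y - F x * F y).

(** Parallelogram identity: adding the rank one kernel of [F - G] to twice the two given kernels
    yields the kernel of [F + G] with constant [2 * C + 2 * D]. *)
Let V_add F G : V F -> V G -> V (fun x => F x + G x).
Proof.
move=> [cF [C C0 hF]] [cG [D D0 hG]]; split.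
  by move=> x; apply: cvgD; [exact: cF|exact: cG].
exists (2 * C + 2 * D); first by rewrite addr_ge0// mulr_ge0.
apply: eq_pd (pdD (pdD (pdZ (ler0n _ 2) hF) (pdZ (ler0n _ 2) hG))
  (pd_rank1 (fun x => F x - G x))) => x y; ring.
Qed.

Let V_scale a F : V F -> V (fun x => a * F x).
Proof.
move=> [cF [C C0 hF]]; split.
  by move=> x; apply: cvgM; [exact: cvg_cst|exact: cF].
exists (a ^+ 2 * C); first by rewrite mulr_ge0// sqr_ge0.
by apply: eq_pd (pdZ (sqr_ge0 a) hF) => x y; ring.
Qed.

Let V_slice y : V (k ^~ y).
Proof. by split=> //; exists (k y y); [exact: pd_ge0|exact: pd_schur_compl]. Qed.

Let moment_cont F n : V F -> continuous (fun x => W x * F x ^+ n).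
Proof.
move=> [cF _] x; apply: cvgM; first exact: W_cont.
apply: (@continuous_comp _ _ _ F (fun t => t ^+ n)); first exact: cF.
exact: exprn_continuous.
Qed.

Let moment_dominated F n : V F -> exists2 c, 0 <= c & pd_kernel (fun x y =>
  c * expR (- g x y) - W x * F x ^+ n * (W y * F y ^+ n)).
Proof.
move=> [_ [C C0 hF]]; exists (n`!%:R * C ^+ n); first by rewrite mulr_ge0// exprn_ge0.
apply: eq_pd (pdM (pd_rank1 W) (pd_exp_dominates n k_pd C0 hF)) => x y.
by rewrite (expN_pd_of_cnd x0)// /W /k; ring.
Qed.

Let moment_bm F n : V F ->
  bounded_measurable ((fun x => W x * F x ^+ n) : borel x0 -> R).
Proof.
move=> VF; have [c c0 hc] := moment_dominated n VF.
exact: (@dominated_bm _ _ x0 (fun x y => expR (- g x y)) _ K_bounded _ _ c0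
  (@moment_cont F n VF) hc).
Qed.

Let moment0 F n : V F ->
  charge_integral nu ((fun x => W x * F x ^+ n) : borel x0 -> R) = 0.
Proof.
move=> VF; have [c c0 hc] := moment_dominated n VF.
exact: (@dominated_integral0 _ _ x0 nu X_hausdorff nu_tight
  (fun x y => expR (- g x y)) _ (cnd_expN_pd g_cnd) K_cont
  K_bounded K_null _ _ c0 (@moment_cont F n VF) hc).
Qed.

(** From [F x ^+ 2 <= C * k x x], the arithmetic-geometric mean inequality gives
    [2 * |F x| <= C + k x x]; squaring the product then leaves [W x ^+ 2 * expR (k x x)], bounded by
    [K_diag]. The [+ 1] in the bound replaces a square root. *)
Let W_exp_bounded F : V F -> exists B, forall x, W x * expR `|F x| <= B.
Proof.
move=> [cF [C C0 hF]]; exists (expR C * expR (- m) + 1) => x.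
have F2 : F x ^+ 2 <= C * k x x by have := pd_ge0 x hF; rewrite subr_ge0 -expr2.
have k0 := pd_ge0 x k_pd.
have Fle : 2 * `|F x| <= C + k x x.
  rewrite -ler_sqr ?nnegrE ?mulr_ge0 ?(addr_ge0 C0 k0)//.
  rewrite exprMn real_normK ?num_real//.
  by move: F2 (sqr_ge0 (C - k x x)); move: (k x x) (F x ^+ 2) => u v; nra.
have : (W x * expR `|F x|) ^+ 2 <= expR C * expR (- m).
  rewrite exprMn -[expR `|F x| ^+ 2]expRM_natr.
  apply: (@le_trans _ _ (W x ^+ 2 * (expR C * expR (k x x)))).
    by rewrite ler_wpM2l ?sqr_ge0// -expRD ler_expR; lra.
  by rewrite mulrCA ler_wpM2l ?expR_ge0.
set t := W x * _; set B := expR C * _ => tB; nra.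
Qed.

Let bW : bounded_measurable (W : borel x0 -> R).
Proof.
split; first exact: (continuous_borel (x0 := x0)).
have V0 : V (fun=> 0).
  by have := V_scale 0 (V_slice x0); under eq_fun do rewrite mul0r.
have [B hB] := W_exp_bounded V0; exists B => x.
by have := hB x; rewrite normr0 expR0 mulr1 ger0_norm// expR_ge0.
Qed.

(* The power series is integrated term by term, the partial sums being
   dominated by [W * exp |F|]. *)
Let series_integral0 (a : nat -> R) (phi : R -> R) F :
  (forall n, `|a n| <= n`!%:R^-1) ->
  (forall t, series (fun n => a n * t ^+ n) @ \oo --> phi t) ->
  V F -> charge_integral nu ((fun x => W x * phi (F x)) : borel x0 -> R) = 0.
Proof.
move=> ha hphi VF; have [B hB] := W_exp_bounded VF.
pose f_ n (x : borel x0) := \sum_(0 <= i < n) a i * (W x * F x ^+ i).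
have bterm i := moment_bm i VF.
have f0 n : charge_integral nu (f_ n) = 0.
  rewrite /f_ charge_integral_sum => [|i]; last exact: bmZ.
  by rewrite big1// => i _; rewrite charge_integralZ// moment0// mulr0.
have fE n x : f_ n x = W x * series (fun i => a i * F x ^+ i) n.
  by rewrite /f_ /series/= mulr_sumr; apply: eq_bigr => i _; rewrite mulrCA.
have : (fun n => charge_integral nu (f_ n)) @ \oo -->
    charge_integral nu ((fun x => W x * phi (F x)) : borel x0 -> R).
  apply: (charge_integral_bounded_cvg (M := B)) => [n|n x|x].
  - by have [] : bounded_measurable (f_ n) by apply: bm_sum => i; exact: bmZ.
  - rewrite fE normrM ger0_norm ?expR_ge0// (le_trans _ (hB x))//.
    rewrite ler_wpM2l ?expR_ge0// /series/= (le_trans (ler_norm_sum _ _ _))//.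
    apply: (@le_trans _ _ (series (exp_coeff `|F x|) n)).
      rewrite /series/= ler_sum// => i _; rewrite normrM normrX /exp_coeff/= mulrC.
      by rewrite ler_wpM2l ?exprn_ge0.
    apply: nondecreasing_cvgn_le; last exact: is_cvg_series_exp_coeff.
    apply/nondecreasing_seqP => j; rewrite /series/= big_nat_recr//= lerDl.
    by rewrite /exp_coeff/= divr_ge0// exprn_ge0.
  - under eq_fun do rewrite fE.
    by apply: cvgM; [exact: cvg_cst|exact: hphi].
under eq_fun do rewrite f0.
by move=> /(cvg_unique (@Rhausdorff R) (cvg_cst 0)) <-.
Qed.

(** Every [F] in [V] vanishes at [x0], because [k x0 x0 = 0]. Constants are therefore adjoined: they
    turn cosines into sines and let a function take opposite signs at two given points. *)
Let V' : set (borel x0 -> R) :=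
  [set G | exists F a, V F /\ G = (fun x => F x + a)].

Let V'_cos G : V' G -> charge_integral nu (fun x => W x * (cos \o G) x) = 0.
Proof.
move=> [F [a [VF ->]]].
have c0 : charge_integral nu ((fun x => W x * cos (F x)) : borel x0 -> R) = 0.
  apply: (series_integral0 (a := fun n => (~~ odd n)%:R * (-1) ^+ n./2 * n`!%:R^-1)) VF.
    move=> n; rewrite !normrM normrX normrN1 expr1n mulr1 ger0_norm//.
    rewrite [`|_^-1|]ger0_norm//.
    by rewrite ler_piMl// lern1 leq_b1.
  move=> t; rewrite (_ : (fun n => _) = cos_coeff t).
    by rewrite unlock; exact: is_cvg_series_cos_coeff.
  by apply/funext => n; rewrite /cos_coeff/= mulrAC.
have s0 : charge_integral nu ((fun x => W x * sin (F x)) : borel x0 -> R) = 0.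
  apply: (series_integral0 (a := fun n => (odd n)%:R * (-1) ^+ n.-1./2 * n`!%:R^-1)) VF.
    move=> n; rewrite !normrM normrX normrN1 expr1n mulr1 ger0_norm//.
    rewrite [`|_^-1|]ger0_norm//.
    by rewrite ler_piMl// lern1 leq_b1.
  move=> t; rewrite (_ : (fun n => _) = sin_coeff t).
    by rewrite unlock; exact: is_cvg_series_sin_coeff.
  by apply/funext => n; rewrite /sin_coeff/= mulrAC.
have bcos : bounded_measurable ((fun x => W x * cos (F x)) : borel x0 -> R).
  apply: (bmM bW); apply: (bm_cos (F := F : borel x0 -> R)).
  exact: (continuous_borel (x0 := x0) VF.1).
have bsin : bounded_measurable ((fun x => W x * sin (F x)) : borel x0 -> R).
  apply: (bmM bW); split; last first.
    by exists 1 => x; rewrite ler_norml sin_geN1 sin_le1.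
  apply: (continuous_borel (x0 := x0)) => x.
  by apply: (@continuous_comp _ _ _ F sin); [exact: VF.1|exact: continuous_sin].
rewrite (_ : (fun x => _) = (fun x : borel x0 =>
    cos a * (W x * cos (F x)) - sin a * (W x * sin (F x)))).
  rewrite charge_integralB; [|exact: bmZ..].
  by rewrite !charge_integralZ// c0 s0 !mulr0 subr0.
by apply/funext => x; rewrite /= cosD; ring.
Qed.

(** For the difference of the slices of [k] at [x] and [y], [F x - F y] is the squared kernel
    distance, that is [2 * g x y - g x x - g y y]. *)
Let V_separates x y : x <> y -> exists F, V F /\ F x <> F y.
Proof.
move=> /g_metr xy; exists (fun u => k u x + -1 * k u y); split.
  by apply: V_add => //; exact: V_scale.
have : 0 < k x x + -1 * k x y - (k y x + -1 * k y y).
  by rewrite /k /pd_of_cnd (g_cnd.1 y x); lra.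
by move=> h e; move: h; rewrite e subrr ltxx.
Qed.

(* [F] is rescaled so that [F x = 1] and [F y = -1]. *)
Let sin_separates x y : x <> y -> exists F, V' F /\ sin (F y) < 0 < sin (F x).
Proof.
move=> /V_separates[F [VF Fxy]].
have d0 : F x - F y != 0 by rewrite subr_eq0; exact/eqP.
exists (fun u => 2 / (F x - F y) * F u + - ((F x + F y) / (F x - F y))); split.
  by exists (fun u => 2 / (F x - F y) * F u), (- ((F x + F y) / (F x - F y)));
    split=> //; exact: V_scale.
have -> : 2 / (F x - F y) * F x + - ((F x + F y) / (F x - F y)) = 1 by field.
have -> : 2 / (F x - F y) * F y + - ((F x + F y) / (F x - F y)) = -1 by field.
rewrite sinN oppr_lt0 andbb sin_gt0_pi// ltr01/=.
by apply: lt_le_trans (pi_ge2 R); rewrite ltr1n.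
Qed.

Hypothesis nu_regular_pos : inner_regular (jordan_pos (hahn_posneg nu)).
Hypothesis nu_regular_neg : inner_regular (jordan_neg (hahn_posneg nu)).

Let V'_meas G : V' G -> measurable_fun setT G.
Proof.
move=> [F [a [[cF _] ->]]]; apply: (continuous_borel (x0 := x0)) => x.
by apply: cvgD; [exact: cF|exact: cvg_cst].
Qed.

Let V'_cst a : V' (fun=> a).
Proof.
exists (fun=> 0), a; split; last by apply/funext => x; rewrite add0r.
by have := V_scale 0 (V_slice x0); under eq_fun do rewrite mul0r.
Qed.

Let V'_add F G : V' F -> V' G -> V' (fun x => F x + G x).
Proof.
move=> [F' [a [VF ->]]] [G' [b [VG ->]]].
exists (fun x => F' x + G' x), (a + b); split; first exact: V_add.
by apply/funext => x; ring.
Qed.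

Let V'_opp F : V' F -> V' (fun x => - F x).
Proof.
move=> [F' [a [VF ->]]]; exists (fun x => -1 * F' x), (- a).
by split; [exact: V_scale|apply/funext => x; ring].
Qed.

Lemma gaussian_null_charge0 (A : set (borel x0)) : measurable A -> nu A = 0%E.
Proof.
move=> mA.
pose S : set (set X) := [set U | stable_set nu W V' U].
have S_sep x y : x <> y -> exists A B : set X,
    [/\ open A, open B, S A, A `&` B = set0 & A x /\ B y].
  move=> /sin_separates[F [VF /andP[Fy Fx]]].
  exists [set u | 0 < sin (F u)], [set u | sin (F u) < 0].
  have /continuousP cF : continuous (fun u : X => sin (F u)).
    have [F' [a [[cF' _] ->]]] := VF.
    move=> u; apply: (@continuous_comp _ _ _ (fun u => F' u + a) sin).
      by apply: cvgD; [exact: cF'|exact: cvg_cst].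
    exact: continuous_sin.
  split=> //.
  - exact: cF _ (@open_gt R 0).
  - exact: cF _ (@open_lt R 0).
  - exact: (stable_sin_gt0 nu bW V'_meas V'_cst V'_add V'_opp VF).
  - by apply/seteqP; split=> // u [/= h1 h2]; have := lt_trans h1 h2; rewrite ltxx.
have sep (C C' : set X) : compact C -> compact C' -> C `&` C' = set0 ->
    exists U : set (borel x0), [/\ measurable U, C `<=` U, U `&` C' = set0 &
      charge_integral nu (fun x => W x * \1_U x) = 0].
  move=> cC cC' CC'.
  have [|||U [SU CU UC']] := separate_compacts x0 _ _ _ S_sep cC cC' CC'.
  - exact: stable_setT.
  - by move=> A' B' SA SB; exact: stable_setI.
  - by move=> A' SA; exact: stable_setC.
  - exists U; split=> //.
      exact: stable_set_measurable SU.
    exact: (stabilizer_integral0 V'_cst V'_cos SU).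
set mp := jordan_pos (hahn_posneg nu); set mn := jordan_neg (hahn_posneg nu).
have [[mP _] [mN _] PN PN0] := hahn_posneg nu.
have mpP : mp (~` hahn_pos nu) = 0%E.
  rewrite /mp jordan_posE cjordan_posE /crestr0 mem_set; last exact: measurableC.
  by rewrite /crestr setICl charge0.
have mnN : mn (~` hahn_neg nu) = 0%E.
  rewrite /mn jordan_negE cjordan_negE /crestr0 mem_set; last exact: measurableC.
  by rewrite /crestr setICl charge0 oppe0.
have W_gt0 x : 0 < W x by exact: expR_gt0.
(* [charge_integral] is the difference of the integrals for [mp] and [mn], so its vanishing is the
   equality of integrals that is required. The two parts exchange roles for [mn]. *)
have mp0 : mp setT = 0%E.
  apply: (mutually_singular_eq0 X_hausdorff bW W_gt0 mP mN PN0 mpP mnN) => //.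
  move=> C C' cC cC' CC'; have [U [mU CU UC' U0]] := sep C C' cC cC' CC'.
  by exists U; split=> //; apply/eqP; rewrite -subr_eq0; exact/eqP.
have mn0 : mn setT = 0%E.
  rewrite setIC in PN0.
  apply: (mutually_singular_eq0 X_hausdorff bW W_gt0 mN mP PN0 mnN mpP) => //.
  move=> C C' cC cC' CC'; have [U [mU CU UC' U0]] := sep C C' cC cC' CC'.
  by exists U; split=> //; apply/esym/eqP; rewrite -subr_eq0; exact/eqP.
have null (mu : {measure set (borel x0) -> \bar R}) : mu setT = 0%E -> mu A = 0%E.
  move=> mu0; apply/eqP; rewrite eq_le measure_ge0 andbT -mu0.
  by apply: le_measure; rewrite ?inE.
rewrite (jordan_decomp (hahn_posneg nu) mA) /cadd/= cscaleN1/=.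
by rewrite (null mp mp0) (null mn mn0) oppe0 adde0.
Qed.

End gaussian_kernel.

(** * Complex Radon measures *)

Section variation.
Context d (T : measurableType d) (R : realType).
Variable l : complex_measure T R.

Lemma Re_norm_ge0 (z : R[i]) : 0 <= complex.Re `|z|.
Proof. by have := normr_ge0 z; rewrite lecE => /andP[]. Qed.

Lemma Re_norm_ge_Re (z : R[i]) : `|complex.Re z| <= complex.Re `|z|.
Proof. by have := normc_ge_Re z; rewrite lecE => /andP[]. Qed.

Lemma Re_norm_ge_Im (z : R[i]) : `|complex.Im z| <= complex.Re `|z|.
Proof.
by case: z => a b /=; rewrite -sqrtr_sqr ler_wsqrtr// lerDr sqr_ge0.
Qed.

Let w A : R := complex.Re `|cm_val l A|.

Let w_ge0 A : 0 <= w A. Proof. exact: Re_norm_ge0. Qed.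

(** [B] is put in front of a partition of [C]. Together with monotonicity, this one inequality
    stands in for additivity of the variation. *)
Lemma cm_variation_prepend (C B : set T) : measurable B ->
  C `&` B = set0 ->
  (cm_variation l C + (complex.Re `|cm_val l B|)%:E <= cm_variation l (C `|` B))%E.
Proof.
move=> mB CB; rewrite -leeBrDr//; apply: ge_ereal_sup => _ [F [mF tF FC] <-].
rewrite leeBrDr// -/(w B); under eq_eseriesr do rewrite -/(w _).
pose G n := if n is k.+1 then F k else B.
have -> : (\sum_(0 <= i <oo) (w (F i))%:E + (w B)%:E = \sum_(0 <= i <oo) (w (G i))%:E)%E.
  rewrite [RHS]nneseries_recl//; last by move=> i _; rewrite lee_fin.
  rewrite addeC -(@nneseries_addn _ (fun i => (w (G i))%:E) 1%N); last first.
    by move=> i; rewrite lee_fin.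
  by congr (_ + _)%E; apply: eq_eseriesr => i _; rewrite addn1.
apply: ereal_sup_ubound; exists G => //; split.
- by case.
- move=> [|i] [|j] _ _ //=.
  + move=> [x [Bx Fx]]; have : (C `&` B) x by split=> //; rewrite -FC; exists j.
    by rewrite CB.
  + move=> [x [Fx Bx]]; have : (C `&` B) x by split=> //; rewrite -FC; exists i.
    by rewrite CB.
  + by move=> h; congr S; exact: tF.
- apply/seteqP; split=> [x [[|i] _ Gx]|x [Cx|Bx]].
  + by right.
  + by left; rewrite -FC; exists i.
  + by move: Cx; rewrite -FC => -[i _ Fx]; exists i.+1.
  + by exists 0%N.
Qed.

Lemma le_cm_variation (A B : set T) : measurable A -> measurable B -> A `<=` B ->
  (cm_variation l A <= cm_variation l B)%E.
Proof.
move=> mA mB AB; have ABA : A `&` (B `\` A) = set0 by rewrite setDE setICA setICr setI0.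
have := cm_variation_prepend (measurableD mB mA) ABA.
rewrite setDUK//; apply: le_trans; rewrite leeDl// lee_fin; exact: w_ge0.
Qed.

(** A non-measurable [A] has no measurable partition, and its variation is the supremum of the empty
    set, [-oo]. *)
Lemma cm_variation_ge0 (A : set T) : measurable A -> (0 <= cm_variation l A)%E.
Proof.
move=> mA; apply: le_ereal_sup_tmp; eexists; last first.
  apply: (nneseries_ge0 (u_ := fun i => (w (if i is 0%N then A else set0))%:E)) => n _ _.
  by rewrite lee_fin.
exists (fun i => if i is 0%N then A else set0) => //.
split=> [[]|[|i] [|j] _ _ [x []]|]//.
by apply/seteqP; split=> [x [[|i] _]|x Ax]//; exists 0%N.
Qed.

End variation.

Section radon.
Context {R : realType} {X : topologicalType} (x0 : X).
Hypothesis X_hausdorff : hausdorff_space X.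

Lemma compact_borel (C : set X) : compact C -> measurable (C : set (borel x0)).
Proof. by move=> cC; apply: closed_borel; exact: compact_closed. Qed.

Variable l : complex_measure (borel x0) R.
Hypothesis l_radon : radon l.

(** Choose [C] with variation above that of [E] minus [e]. For [B] in the rest of [E], the variation
    of [C] plus the modulus of [l] on [B] is at most the variation of [E]. *)
Lemma radon_approx (E : set (borel x0)) (e : R) : measurable E -> 0 < e ->
  exists C : set X, [/\ compact C, C `<=` E & forall B : set (borel x0),
    measurable B -> B `<=` E `\` C -> complex.Re `|cm_val l B| <= e].
Proof.
move=> mE e0; have [lT /(_ E mE)[El _]] := l_radon.
have fin (A : set (borel x0)) : measurable A -> cm_variation l A \is a fin_num.
  move=> mA; rewrite ge0_fin_numE ?cm_variation_ge0//.
  by apply: le_lt_trans lT; exact: le_cm_variation.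
have finE := fin E mE.
have [|_ [C [cC CE] <-]] := ub_ereal_sup_adherent e0 (S :=
  [set cm_variation l C | C in [set C : set X | compact C /\ C `<=` E]]).
  by rewrite -El.
rewrite -El => hC; exists C; split=> // B mB BE.
have mC := compact_borel cC; have finC := fin C mC.
have CB : C `&` B = set0.
  by apply/seteqP; split=> // x [Cx /BE []].
have h1 := cm_variation_prepend l mB CB.
have h2 : (cm_variation l (C `|` B) <= cm_variation l E)%E.
  apply: le_cm_variation => //; first exact: measurableU.
  by move=> x [/CE//|/BE []].
have := le_trans h1 h2; move: hC; rewrite -(fineK finE) -(fineK finC).
rewrite -EFinB -EFinD lte_fin lee_fin; lra.
Qed.

Variable nu : {charge set (borel x0) -> \bar R}.
Hypothesis nu_le : forall A, measurable A -> `|fine (nu A)| <= complex.Re `|cm_val l A|.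

Let jordan_pos_le (A : set (borel x0)) : measurable A ->
  (jordan_pos (hahn_posneg nu) A <= (complex.Re `|cm_val l (A `&` hahn_pos nu)|)%:E)%E.
Proof.
move=> mA; have [[mP _] _ _ _] := hahn_posneg nu.
have mAP : measurable (A `&` hahn_pos nu) by exact: measurableI.
rewrite jordan_posE cjordan_posE /crestr0 mem_set// /crestr.
rewrite -(fineK (fin_num_measure nu _ mAP)) lee_fin.
by rewrite (le_trans (ler_norm _))//; exact: nu_le.
Qed.

Let jordan_neg_le (A : set (borel x0)) : measurable A ->
  (jordan_neg (hahn_posneg nu) A <= (complex.Re `|cm_val l (A `&` hahn_neg nu)|)%:E)%E.
Proof.
move=> mA; have [_ [mN _] _ _] := hahn_posneg nu.
have mAN : measurable (A `&` hahn_neg nu) by exact: measurableI.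
rewrite jordan_negE cjordan_negE /crestr0 mem_set// /crestr.
rewrite -(fineK (fin_num_measure nu _ mAN)) -EFinN lee_fin.
by rewrite (le_trans (ler_norm _))// normrN; exact: nu_le.
Qed.

Lemma radon_inner_regular_pos : inner_regular (jordan_pos (hahn_posneg nu)).
Proof.
move=> E e mE e0; have [C [cC CE hC]] := radon_approx mE e0.
have mEC : measurable (E `\` C) by apply: measurableD => //; exact: compact_borel.
have [[mP _] _ _ _] := hahn_posneg nu.
exists C; split=> //; apply: (le_trans (jordan_pos_le mEC)); rewrite lee_fin hC//.
exact: measurableI.
Qed.

Lemma radon_inner_regular_neg : inner_regular (jordan_neg (hahn_posneg nu)).
Proof.
move=> E e mE e0; have [C [cC CE hC]] := radon_approx mE e0.
have mEC : measurable (E `\` C) by apply: measurableD => //; exact: compact_borel.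
have [_ [mN _] _ _] := hahn_posneg nu.
exists C; split=> //; apply: (le_trans (jordan_neg_le mEC)); rewrite lee_fin hC//.
exact: measurableI.
Qed.

Lemma radon_tight (e : R) : 0 < e ->
  exists2 C : set X, compact C & charge_mass nu (~` C) <= e.
Proof.
move=> e0; have e20 : 0 < e / 2 by rewrite divr_gt0.
have [C [cC _ hC]] := @radon_approx setT _ measurableT e20.
exists C => //; have mC : measurable (~` C : set (borel x0)).
  by apply: measurableC; exact: compact_borel.
have [[mP _] [mN _] _ _] := hahn_posneg nu.
have sub (S : set (borel x0)) : ~` C `&` S `<=` setT `\` C by move=> x [].
have := jordan_pos_le mC; have := jordan_neg_le mC.
rewrite -(fineK (fin_num_measure (jordan_pos (hahn_posneg nu)) _ mC)).
rewrite -(fineK (fin_num_measure (jordan_neg (hahn_posneg nu)) _ mC)) !lee_fin.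
have := hC _ (measurableI _ _ mC mP) (sub _).
have := hC _ (measurableI _ _ mC mN) (sub _).
rewrite /charge_mass; lra.
Qed.

End radon.

Section charge_integral_special.
Context d (T : measurableType d) (R : realType).
Implicit Types (nu : {charge set T -> \bar R}) (f : T -> R).

Lemma charge_integral_copp nu f : bounded_measurable f ->
  charge_integral (copp nu) f = - charge_integral nu f.
Proof.
move=> bf; rewrite (charge_integralE (m1 := jordan_neg (hahn_posneg nu))
  (m2 := jordan_pos (hahn_posneg nu)) _ bf) ?opprB// => A mA.
transitivity (- nu A)%E => //.
rewrite (jordan_decomp (hahn_posneg nu) mA) /cadd/= cscaleN1/=.
by rewrite fin_num_oppeB ?fin_num_measure// addeC.
Qed.

Lemma charge_integral_czero f : bounded_measurable f ->
  charge_integral (czero : {charge set T -> \bar R}) f = 0.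
Proof.
move=> bf; set mu := jordan_pos (hahn_posneg (czero : {charge set T -> \bar R})).
rewrite (charge_integralE (m1 := mu) (m2 := mu) _ bf) ?subrr// => A mA.
by rewrite subee ?fin_num_measure.
Qed.

Lemma charge_integral_indic nu (A : set T) : measurable A ->
  charge_integral nu (\1_A) = fine (nu A).
Proof.
move=> mA; rewrite /charge_integral /Rintegral !integral_indic// !setIT.
rewrite (jordan_decomp (hahn_posneg nu) mA) /cadd/= cscaleN1.
by rewrite fineB// fin_num_measure.
Qed.

Lemma charge_integral_concentrated nu (C : set T) f : measurable C ->
  (forall A, measurable A -> A `&` C = set0 -> nu A = 0%E) ->
  bounded_measurable f -> (forall x, C x -> f x = 0) -> charge_integral nu f = 0.
Proof.
move=> mC nuC bf f0; have [_ [M fM]] := bf.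
have M0 : 0 <= `|M| by [].
have := @normr_charge_integral _ _ _ nu f C `|M| 0 mC bf M0 (lexx 0)
  (fun x => le_trans (fM x) (ler_norm M)).
have [[mP _] [mN _] _ _] := hahn_posneg nu.
have mC' := measurableC mC.
have null (S : set T) : measurable S -> nu (~` C `&` S) = 0%E.
  move=> mS; apply: nuC; first exact: measurableI.
  by rewrite setIAC setICl set0I.
have -> : charge_mass nu (~` C) = 0.
  rewrite /charge_mass jordan_posE cjordan_posE /crestr0 mem_set// /crestr null//.
  by rewrite jordan_negE cjordan_negE /crestr0 mem_set// /crestr null// oppe0 addr0.
rewrite mul0r mulr0 addr0 => /(_ (fun x Cx => ltac:(by rewrite f0 ?normr0))).
by rewrite normr_le0 => /eqP.
Qed.

End charge_integral_special.

(** * Measures supported by two points *)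

Section two_point_charge.
Context {R : realType} {X : topologicalType} (x0 : X).
Hypothesis X_hausdorff : hausdorff_space X.
Variables (x y : X) (a b : R).
Hypothesis xy : x <> y.

Definition two_point_charge : {charge set (borel x0) -> \bar R} :=
  cadd (cscale a (charge_of_finite_measure (dirac (x : borel x0))))
       (cscale b (charge_of_finite_measure (dirac (y : borel x0)))).

Lemma two_point_chargeE (A : set (borel x0)) :
  two_point_charge A = (a * \1_A x + b * \1_A y)%:E.
Proof. by rewrite /two_point_charge/= /cadd/= /cscale/= !diracE EFinD !EFinM !indicE. Qed.

Let l := ComplexMeasure two_point_charge (czero : {charge set (borel x0) -> \bar R}).

Let lE (A : set (borel x0)) : cm_val l A = (a * \1_A x + b * \1_A y)%:C.
Proof. by rewrite /cm_val two_point_chargeE. Qed.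

Let wE (A : set (borel x0)) :
  complex.Re `|cm_val l A| = `|a * \1_A x + b * \1_A y|.
Proof. by rewrite lE normc_def/= expr0n/= addr0 sqrtr_sqr. Qed.

Let finite_borel (S : set X) : finite_set S ->
  compact S /\ measurable (S : set (borel x0)).
Proof. by move=> /finite_compact cS; split=> //; exact: compact_borel. Qed.

(** The value of [l] on a set depends only on which of [x] and [y] it contains, so intersecting a
    partition of [B] with [A] changes no term. *)
Let variation_restrict (A B : set (borel x0)) : measurable A -> measurable B ->
  A `<=` B -> (B `\` A) `&` [set x; y] = set0 -> cm_variation l B = cm_variation l A.
Proof.
move=> mA mB AB BA; apply/eqP; rewrite eq_le; apply/andP.
split; last exact: le_cm_variation.
apply: ge_ereal_sup => _ [F [mF tF FB] <-]; apply: ereal_sup_ubound.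
have inA z i : [set x; y] z -> F i z -> A z.
  move=> zxy Fz; apply: contrapT => nAz.
  have : ((B `\` A) `&` [set x; y]) z by split=> //; split=> //; rewrite -FB; exists i.
  by rewrite BA.
exists (fun i => F i `&` A).
  split=> [i||]; first exact: measurableI.
    by move=> i j _ _ [z [[Fiz _] [Fjz _]]]; apply: tF => //; exists z.
  by rewrite -setI_bigcupl FB; apply/setIidr.
apply: eq_eseriesr => i _; rewrite !wE.
congr (`|a * _ + b * _|%:E); rewrite !indicE in_setI.
  by case: (boolP (x \in F i)) => //= /set_mem/inA Fx; rewrite mem_set//; apply: Fx; left.
by case: (boolP (y \in F i)) => //= /set_mem/inA Fy; rewrite mem_set//; apply: Fy; right.
Qed.

Lemma two_point_radon : radon l.
Proof.
have fin2 S : finite_set ([set x; y] `&` S) by apply: finite_setIl; exact: finite_set2.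
split.
  apply: (@le_lt_trans _ _ (`|a| + `|b|)%:E); last exact: ltry.
  apply: ge_ereal_sup => _ [F [mF tF FT] <-].
  apply: (@le_trans _ _ (\sum_(0 <= i <oo) (`|a|%:E * dirac (x : borel x0) (F i) +
      `|b|%:E * dirac (y : borel x0) (F i)))%E).
    apply: lee_nneseries => i _; first by rewrite lee_fin Re_norm_ge0.
    rewrite wE !diracE -!EFinM -EFinD lee_fin !indicE.
    rewrite (le_trans (ler_normD _ _))// !normrM.
    by rewrite !(@ger0_norm _ (_%:R)).
  rewrite nneseriesD; [|by move=> i _ _; rewrite mule_ge0..].
  rewrite !nneseriesZl//.
  have sum1 (z : borel x0) : (\sum_(0 <= i <oo) dirac z (F i) = 1%:E :> \bar R)%E.
    rewrite (cvg_lim _ (@measure_semi_sigma_additive _ _ _ (dirac z) F mF tF _))//.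
      by rewrite /= FT diracE in_setT.
    by rewrite FT.
  by rewrite !sum1 !mule1 -EFinD.
move=> E mE; split; apply/eqP; rewrite eq_le; apply/andP; split.
- have [cC mC] := finite_borel (fin2 E).
  rewrite (variation_restrict mC mE).
  + by apply: ereal_sup_ubound; exists ([set x; y] `&` E) => //; split=> // z [].
  + by move=> z [].
  + by apply/seteqP; split=> // z [[Ez nz] zxy]; apply: nz.
- apply: ge_ereal_sup => _ [C [cC CE] <-]; apply: le_cm_variation => //.
  exact: compact_borel.
- apply: le_ereal_inf_tmp => _ [U [oU EU] <-]; apply: le_cm_variation => //.
  exact: open_borel.
(* The optimal open set is the whole space without those of the two points that lie outside [E]. *)
- have [cC mC] := finite_borel (fin2 (~` E)).
  have EU : E `<=` ~` ([set x; y] `&` ~` E) by move=> z Ez [_]; apply.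
  rewrite -(variation_restrict mE (measurableC mC) EU).
    apply: ereal_inf_lbound; exists (~` ([set x; y] `&` ~` E)) => //; split=> //.
    by apply: closed_openC; exact: compact_closed.
  by apply/seteqP; split=> // z [[nz nE] zxy]; apply: nz.
Qed.

Lemma two_point_integral f : bounded_measurable (f : borel x0 -> R) ->
  charge_integral two_point_charge f = a * f x + b * f y.
Proof.
move=> bf; have m1 z : measurable ([set z] : set (borel x0)).
  by have [] := finite_borel (finite_set1 z).
pose u (z : borel x0) := f x * \1_[set x] z + f y * \1_[set y] z.
have bz z : bounded_measurable (fun t : borel x0 => f z * \1_[set z] t).
  by apply: bmZ; apply: bm_indic; exact: m1.
have bu : bounded_measurable u by exact: bmD.
have xNy : (x == y) = false by apply/eqP.
(* [f] and [u] agree on the two points that carry the charge, and [u] is a combination of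
   indicators. *)
have : charge_integral two_point_charge (fun z => f z - u z) = 0.
  apply: (@charge_integral_concentrated _ _ _ _ ([set x; y] : set (borel x0))).
  - by have [] := finite_borel (finite_set2 x y).
  - move=> S mS S0; rewrite two_point_chargeE !indicE !memNset ?mulr0 ?addr0//.
      move=> Sy; have : (S `&` [set x; y]) y by split=> //; right.
      by rewrite S0.
    move=> Sx; have : (S `&` [set x; y]) x by split=> //; left.
    by rewrite S0.
  - exact: bmB.
  - by move=> z [->|->]; rewrite /u !indicE !in_set1 eqxx ?xNy 1?eq_sym ?xNy
      ?mulr1 ?mulr0 ?addr0 ?add0r subrr.
rewrite charge_integralB// => /eqP; rewrite subr_eq0 => /eqP ->.
rewrite charge_integralD// !charge_integralZ; [|by apply: bm_indic; exact: m1..].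
rewrite !charge_integral_indic// !two_point_chargeE/= !indicE !in_set1 !eqxx.
rewrite xNy eq_sym xNy.
rewrite /=; ring.
Qed.

End two_point_charge.

(** * Positive definiteness and reproducing kernel spaces *)

Lemma Re_sum (R : realType) (I : Type) (r : seq I) (F : I -> R[i]) :
  complex.Re (\sum_(i <- r) F i) = \sum_(i <- r) complex.Re (F i).
Proof. by apply: (big_morph (@complex.Re R)) => [[a b] [c d]|]. Qed.

Lemma Im_sum (R : realType) (I : Type) (r : seq I) (F : I -> R[i]) :
  complex.Im (\sum_(i <- r) F i) = \sum_(i <- r) complex.Im (F i).
Proof. by apply: (big_morph (@complex.Im R)) => [[a b] [c d]|]. Qed.

(** With [c = a + i b], the real part of the sum is the form of [K] at [a] plus that at [b], and the
    imaginary part cancels by symmetry. *)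
Lemma pos_def_real (R : realType) (X : Type) (K : X -> X -> R) :
  pd_kernel K -> pos_def (fun x y => (K x y)%:C).
Proof.
move=> [sK hK] n x c _.
pose a i := complex.Re (c i); pose b i := complex.Im (c i).
have term i j : c i * (c j)^* * (K (x i) (x j))%:C =
    ((a i * a j + b i * b j) * K (x i) (x j)) +i*
    (b i * a j * K (x i) (x j) - a i * b j * K (x i) (x j)).
  rewrite /a /b; case: (c i) (c j) => [p q] [s t].
  by apply/eqP; rewrite eq_complex/=; apply/andP; split; apply/eqP; ring.
rewrite lecE; apply/andP; split.
  rewrite Im_sum; under eq_bigr do rewrite Im_sum; apply/eqP.
  under eq_bigr do (under eq_bigr do rewrite term/=; rewrite sumrB).
  transitivity (0 : R) => //; apply/eqP.
  rewrite sumrB [X in _ - X]exchange_big/= subr_eq0; apply/eqP.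
  apply: eq_bigr => i _; apply: eq_bigr => j _.
  by rewrite sK; ring.
rewrite Re_sum; under eq_bigr do rewrite Re_sum.
under eq_bigr do (under eq_bigr do rewrite term/= mulrDl; rewrite big_split).
by rewrite big_split addr_ge0.
Qed.

Section rkhs_continuity.
Context {R : realType} {X : topologicalType}.
Variables (K : X -> X -> R) (H : set (X -> R[i])).
Variable ip : (X -> R[i]) -> (X -> R[i]) -> R[i].
Hypothesis K_pd : pd_kernel K.
Hypothesis K_cont : continuous (fun p : X * X => K p.1 p.2).
Hypothesis HK : is_rkhs (fun x y => (K x y)%:C) H ip.

(** Cauchy-Schwarz for [F x - F y], the inner product of [F] with the difference of the kernel
    functions at [x] and [y]; [B] is the squared norm of [F]. *)
Lemma rkhs_bound F : H F -> exists2 B, 0 <= B & forall x y,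
  complex.Re `|F x - F y| ^+ 2 <= B * pd_dist2 K x y.
Proof.
move=> HF; exists (complex.Re (ip F F)).
  by have := rkhs_ip_ge0 HK HF; rewrite lecE => /andP[].
move=> x y; pose p := complex.Re (ip F F); rewrite -/p.
have p0 : 0 <= p by have := rkhs_ip_ge0 HK HF; rewrite lecE => /andP[].
have pE : ip F F = p%:C.
  have := rkhs_ip_ge0 HK HF; rewrite lecE /p; case: (ip F F) => u v /= /andP[/eqP -> _].
  by [].
pose G u : R[i] := -1 * (K u y)%:C + (K u x)%:C.
have Hx := rkhs_kernel HK x; have Hy := rkhs_kernel HK y.
have HG : H G by exact: (rkhs_lin HK (-1) Hy Hx).
pose s := F x - F y; pose n := complex.Re s ^+ 2 + complex.Im s ^+ 2.
have ipFG : ip F G = s.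
  rewrite (rkhs_ip_herm HK HG HF) (rkhs_ip_lin HK (-1) Hy Hx HF).
  rewrite (rkhs_ip_herm HK HF Hy) (rkhs_ip_herm HK HF Hx) !(rkhs_repr HK) //.
  rewrite /s; case: (F x) (F y) => [u v] [u' v'].
  by apply/eqP; rewrite eq_complex/=; apply/andP; split; apply/eqP; ring.
have ipGG : ip G G = (pd_dist2 K x y)%:C.
  rewrite (rkhs_ip_lin HK (-1) Hy Hx HG).
  rewrite (rkhs_ip_herm HK HG Hy) (rkhs_ip_herm HK HG Hx) !(rkhs_repr HK) //.
  rewrite /G /pd_dist2 (K_pd.1 y x).
  by apply/eqP; rewrite eq_complex/=; apply/andP; split; apply/eqP; ring.
have nE : complex.Re `|F x - F y| ^+ 2 = n.
  by rewrite normc_def/= sqr_sqrtr// addr_ge0// sqr_ge0.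
rewrite nE; have n0 : 0 <= n by rewrite addr_ge0// sqr_ge0.
have norm_expand (z : R[i]) (t D q : R) :
    t%:C * z * (t%:C * z * D%:C + z)^* + (t%:C * z * z^* + q%:C)^* =
    (t ^+ 2 * ((complex.Re z ^+ 2 + complex.Im z ^+ 2) * D) +
     2 * t * (complex.Re z ^+ 2 + complex.Im z ^+ 2) + q)%:C.
  case: z => u v.
  by apply/eqP; rewrite eq_complex/=; apply/andP; split; apply/eqP; ring.
(* The squared norm of [t * s * G + F] for real [t]. The factor [s], the inner product of [F] and
   [G], makes the cross term real, so that the real discriminant applies; it leaves an extra factor
   [n] to cancel. *)
have quad t : 0 <= t ^+ 2 * (n * pd_dist2 K x y) + 2 * t * n + p.
  pose E u := (t%:C * s) * G u + F u.
  have HE : H E by exact: (rkhs_lin HK _ HG HF).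
  have := rkhs_ip_ge0 HK HE.
  rewrite (rkhs_ip_lin HK _ HG HF HE) (rkhs_ip_herm HK HE HG) (rkhs_ip_herm HK HE HF).
  rewrite !(rkhs_ip_lin HK _ HG HF) // ipGG ipFG (rkhs_ip_herm HK HF HG) ipFG pE.
  by rewrite norm_expand lecR.
have := quadratic_discr quad.
have [->|nN0] := eqVneq n 0; first by rewrite mulr_ge0// pd_dist2_ge0.
have n_gt0 : 0 < n by rewrite lt_neqAle eq_sym nN0.
by rewrite expr2 -mulrA ler_pM2l// mulrC.
Qed.

Lemma rkhs_continuous F : H F -> continuous (F : X -> R[i]^o).
Proof.
move=> HF x; have [B B0 hB] := rkhs_bound HF.
apply/cvgrPdist_lt => e; rewrite ltcE/= => /andP[/eqP e_real e0].
have : \forall y \near x, pd_dist2 K y x < complex.Re e ^+ 2 / (B + 1).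
  have := @cont_pd_dist2 _ _ K K_cont x x; rewrite /continuous_at pd_dist2xx.
  by move=> /cvgr_lt; apply; rewrite divr_gt0 ?exprn_gt0// ltr_wpDl.
apply: filterS => y; rewrite ltr_pdivlMr ?ltr_wpDl// => hy.
have := hB y x; have d0 := pd_dist2_ge0 y x K_pd.
rewrite distrC normc_def/= ltcE/= e_real eqxx/= => hF.
rewrite -(@ltr_sqr _ _ (complex.Re e)) ?nnegrE ?sqrtr_ge0 ?(ltW e0)//.
by apply: le_lt_trans hF _; nra.
Qed.

End rkhs_continuity.

(** * Reduction of complex measures to charges, and the equivalence *)

Lemma cm_integral_real d (T : measurableType d) (R : realType)
    (l : complex_measure T R) (f : T -> R) :
  cm_integral l (fun x => (f x)%:C) =
  charge_integral (cm_re l) f +i* charge_integral (cm_im l) f.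
Proof. by rewrite /cm_integral/= !charge_integral0 subr0 add0r. Qed.

Lemma continuous_expN (R : realType) (X : topologicalType) (g : X -> R) :
  continuous g -> continuous (fun x => expR (- g x)).
Proof.
move=> cg x; apply: (@continuous_comp _ _ _ (fun x => - g x) expR).
  by apply: cvgN; exact: cg.
exact: continuous_expR.
Qed.

Lemma expN_ispd (R : realType) (X : topologicalType) (gamma : X -> X -> R) (m : R) :
  hausdorff_space X -> continuous (fun p : X * X => gamma p.1 p.2) ->
  cond_neg_def gamma -> metrizable gamma -> (forall x, m <= gamma x x) ->
  ispd (fun x y => (expR (- gamma x y))%:C).
Proof.
move=> hX cg cnd metr lb.
have K_pd := cnd_expN_pd cnd.
have K_cont := continuous_expN cg.
have K_bounded x : expR (- gamma x x) <= expR (- m) by rewrite ler_expR lerN2.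
split.
- exists (expR (- m)) => x y; have := pd_bounded K_pd K_bounded x y.
  by rewrite normc_def/= expr0n addr0 sqrtr_sqr lecR.
- exact: pos_def_real.
- by move=> H ip HK F HF; exact: (rkhs_continuous K_pd K_cont HK).
move=> x0 l l_radon l_null A mA.
have bK y : bounded_measurable ((fun x => expR (- gamma x y)) : borel x0 -> R).
  exact: (@bm_slice _ _ x0 (fun x y => expR (- gamma x y)) _ K_pd K_cont K_bounded).
pose J (nu : {charge set (borel x0) -> \bar R}) (y : borel x0) :=
  charge_integral nu ((fun x => expR (- gamma x y)) : borel x0 -> R).
have bJ nu : bounded_measurable (J nu).
  exact: (@bm_charge_integral_slice _ _ x0 nu (fun x y => expR (- gamma x y)) _
    K_pd K_cont K_bounded).
have re_le B : measurable B -> `|fine (cm_re l B)| <= complex.Re `|cm_val l B|.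
  by move=> _; exact: (Re_norm_ge_Re (cm_val l B)).
have im_le B : measurable B -> `|fine (cm_im l B)| <= complex.Re `|cm_val l B|.
  by move=> _; exact: (Re_norm_ge_Im (cm_val l B)).
have J_ge0 (nu : {charge set (borel x0) -> \bar R}) :
    (forall B, measurable B -> `|fine (nu B)| <= complex.Re `|cm_val l B|) ->
    0 <= charge_integral nu (J nu).
  move=> nu_le.
  exact: (@pd_double_integral_ge0 _ _ x0 nu hX (radon_tight hX l_radon nu_le)
    (fun x y => expR (- gamma x y)) _ K_pd K_cont K_bounded).
(* The real part of the complex double integral is the sum of those of the real and imaginary parts
   of [l]. Both are nonnegative, so both vanish. *)
have sum0 : charge_integral (cm_re l) (J (cm_re l)) +
    charge_integral (cm_im l) (J (cm_im l)) = 0.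
  move: l_null; under eq_fun do rewrite cm_integral_real.
  move=> /(congr1 (@complex.Re R)); rewrite /cm_integral/=.
  by rewrite charge_integral_copp; [rewrite opprK|exact: bJ].
have re0 : charge_integral (cm_re l) (J (cm_re l)) = 0.
  by have := J_ge0 _ re_le; have := J_ge0 _ im_le; move: sum0; lra.
have im0 : charge_integral (cm_im l) (J (cm_im l)) = 0.
  by move: sum0; rewrite re0 add0r.
rewrite /cm_val.
rewrite (gaussian_null_charge0 hX cg cnd lb metr (radon_tight hX l_radon re_le) re0
  (radon_inner_regular_pos hX l_radon re_le)
  (radon_inner_regular_neg hX l_radon re_le) mA).
by rewrite (gaussian_null_charge0 hX cg cnd lb metr (radon_tight hX l_radon im_le) im0
  (radon_inner_regular_pos hX l_radon im_le)
  (radon_inner_regular_neg hX l_radon im_le) mA).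
Qed.

Theorem theorem4p2 (R : realType) (X : topologicalType) (gamma : X -> X -> R)
    (X_hausdorff : hausdorff_space X)
    (gamma_cont : continuous (fun p : X * X => gamma p.1 p.2))
    (gamma_cnd : cond_neg_def gamma) :
  ispd (fun x y => (expR (- gamma x y))%:C) <->
  metrizable gamma /\ (exists m : R, forall x, m <= gamma x x).
Proof.
split=> [[[M hM] _ _ h0]|[metr [m lb]]]; last exact: expN_ispd metr lb.
have [m lb] : exists m, forall x, m <= gamma x x.
  (* From [1 - gamma x x <= expR (- gamma x x) <= M]. *)
  exists (- M) => x; have := hM x x.
  rewrite normc_def/= expr0n addr0 sqrtr_sqr lecR gtr0_norm ?expR_gt0//.
  by have := expR_ge1Dx (- gamma x x); lra.
split; last by exists m.
move=> x y xy; rewrite lt_neqAle cnd_diag_le// andbT; apply/eqP => eq_g.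
have K_pd := cnd_expN_pd gamma_cnd.
have K_cont := continuous_expN gamma_cont.
have K_bounded z : expR (- gamma z z) <= expR (- m) by rewrite ler_expR lerN2.
have bK z : bounded_measurable ((fun u => expR (- gamma u z)) : borel x -> R).
  exact: (@bm_slice _ _ x (fun x y => expR (- gamma x y)) _ K_pd K_cont K_bounded).
pose a := expR (gamma x x / 2); pose c := expR (gamma y y / 2).
pose l := ComplexMeasure (two_point_charge x x y a (- c))
  (czero : {charge set (borel x) -> \bar R}).
pose u (z : borel x) := a * expR (- gamma x z) + - c * expR (- gamma y z).
have bu : bounded_measurable u.
  by apply: bmD; apply: bmZ; under eq_fun do rewrite gamma_cnd.1; exact: bK.
have : cm_val l [set x] = 0.
  apply: (h0 x l (two_point_radon x X_hausdorff x y a (- c))); last first.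
    by apply: compact_borel X_hausdorff _ _; exact: compact_set1.
  rewrite (_ : (fun z => cm_integral l _) = fun z => (u z)%:C); last first.
    apply/funext => z; rewrite cm_integral_real charge_integral_czero//.
    by rewrite (two_point_integral X_hausdorff _ _ xy (bK z)).
  rewrite cm_integral_real /= charge_integral_copp// charge_integral_czero// oppr0.
  rewrite (two_point_integral X_hausdorff _ _ xy bu) /u.
  have a0 : a != 0 by rewrite gt_eqF// expR_gt0.
  have c0 : c != 0 by rewrite gt_eqF// expR_gt0.
  have -> : expR (- gamma x x) = (a * a)^-1.
    by rewrite /a -expRD -expRN; congr expR; field.
  have -> : expR (- gamma y y) = (c * c)^-1.
    by rewrite /c -expRD -expRN; congr expR; field.
  (* This is where [eq_g] is used. With these weights the four terms of the double integral are 1,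
     -1, -1 and 1. *)
  have exy : expR (- gamma x y) = (a * c)^-1.
    by rewrite /a /c -expRD -expRN; congr expR; lra.
  rewrite (gamma_cnd.1 y x) exy; congr (_ +i* _); field; exact/andP.
move=> /(congr1 (@complex.Re R)); rewrite /cm_val two_point_chargeE/=.
rewrite !indicE in_set1 eqxx memNset/=; last exact/nesym.
by rewrite mulr1 mulr0 addr0 => /eqP; rewrite gt_eqF// expR_gt0.
Qed.
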